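(* Let $X$ be a Banach space with a tight by support basis. Let $(x_n)$ be a block sequence in $X$ and let $T:[x_n]\to X$ be a bounded operator on the block subspace $[x_n]\subset X$. Then there is an infinite dimensional block subspace $W\subset[x_n]$ such that $T|_W=\alpha\,\mathrm{Id}|_W+S|_W$ for some scalar $\alpha$ and some bounded strictly singular operator $S:[x_n]\to X$.
   Context: Let $X$ be a Banach space with a (Schauder) basis $(e_i)$. The support of $x=\sum_i x_ie_i$ is $\operatorname{supp}x=\{i\in\mathbb{N}:x_i\neq0\}$; the support of a subspace is the union of the supports of its elements. ''Subspace'' means closed linear subspace. The basis $(e_i)$ is called tight by support if no two infinite dimensional subspaces of $X$ with disjoint supports are isomorphic. A block sequence is a sequence $(x_n)$ of non-zero finitely supported vectors with $\max\operatorname{supp}x_n<\min\operatorname{supp}x_{n+1}$ for all $n$; $[x_n]$ denotes the closed linear span of $(x_n)$, and the closed span of an infinite block sequence is called a block subspace. A bounded operator is strictly singular if none of its restrictions to an infinite dimensional subspace is an isomorphism onto its image. *)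

(* Defs.v *)
From HB Require Import structures.
From mathcomp Require Import all_boot all_order all_algebra.
From mathcomp Require Import all_classical all_reals all_analysis.
From mathcomp Require Import complex.

Set Implicit Arguments.
Unset Strict Implicit.
Unset Printing Implicit Defensive.

Import Order.TTheory GRing.Theory Num.Theory.
Import numFieldNormedType.Exports.

Local Open Scope classical_set_scope.
Local Open Scope ring_scope.

Section Defs.
Context {K : numFieldType} {X : normedModType K}.
Implicit Types (e x : nat -> X) (Y Z : set X) (T S : X -> X).

Definition is_expansion e (x : X) (a : nat -> K) : Prop :=
  series (fun i => a i *: e i) @ \oo --> x.

Definition schauder_basis e : Prop :=
  forall x : X, exists! a : nat -> K, is_expansion e x a.

(* Only meaningful when e is a Schauder basis, in which case the expansion
   exists and is unique; junk value 0 otherwise. *)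
Definition basis_coord e (x : X) : nat -> K :=
  xget (fun=> 0) [set a | is_expansion e x a].

Definition supp e (x : X) : set nat := [set i | basis_coord e x i != 0].

Definition supp_set e Y : set nat := \bigcup_(x in Y) supp e x.

Definition lin_span (A : set X) : set X :=
  [set y | exists n (c : 'I_n -> K) (v : 'I_n -> X),
    (forall i, A (v i)) /\ y = \sum_(i < n) c i *: v i].

Definition closed_span x : set X := closure (lin_span (range x)).

Definition closed_subspace Y : Prop := closed Y /\ GRing.submod_closed (mem Y).

Definition infinite_dim Y : Prop :=
  ~ exists s : seq X, Y `<=` lin_span [set` s].

(* An operator with domain Y is represented by a total function X -> X of which
   only the values on Y matter. *)
Definition bounded_operator Y T : Prop :=
  (forall a : K, {in Y &, forall u v, T (a *: u + v) = a *: T u + T v}) /\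
  exists M : K, {in Y, forall u, `|T u| <= M * `|u|}.

Definition isomorphism Y Z T : Prop :=
  [/\ bounded_operator Y T, T @` Y = Z &
      exists2 T' : X -> X, bounded_operator Z T' & {in Y, cancel T T'}].

Definition isomorphic Y Z : Prop := exists T, isomorphism Y Z T.

Definition tight_by_support e : Prop :=
  schauder_basis e /\
  forall Y Z, closed_subspace Y -> closed_subspace Z -> infinite_dim Y -> infinite_dim Z ->
    supp_set e Y `&` supp_set e Z = set0 -> ~ isomorphic Y Z.

Definition block_sequence e x : Prop :=
  (forall n, x n != 0 /\ finite_set (supp e (x n))) /\
  (forall n i j, supp e (x n) i -> supp e (x n.+1) j -> (i < j)%N).

Definition block_subspace e Y : Prop :=
  exists2 x, block_sequence e x & Y = closed_span x.

Definition strictly_singular Y S : Prop :=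
  forall V, closed_subspace V -> V `<=` Y -> infinite_dim V ->
    ~ isomorphism V (S @` V) S.

End Defs.

(* Main.v *)
Require Import Defs.
From HB Require Import structures.
From mathcomp Require Import all_boot all_order all_algebra.
From mathcomp Require Import all_classical all_reals all_analysis.
From mathcomp Require Import complex.
From mathcomp Require Import ring lra.

(** Tightness by support forces the basis to be unconditional: otherwise some
    successive blocks [u] would be tiny compared with the restriction [y] of [u]
    to a set of coordinates, so that [y] and [y - u] would be nearly equal,
    generate isomorphic subspaces, and yet have disjoint supports
    ([unconditional_tail]).  Hence multipliers with bounded coefficients are
    bounded ([multiplier_bounded]).

    The heart of the matter is to find a scalar [a] such that [T - a] is as small
    as desired on vectors [v] supported arbitrarily far out
    ([approximate_eigenvalue]).  In the infinite dimensional span of [x] there is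
    a vector such that its first [m] coordinates and those of its image vanish.
    This yields a block sequence [y] for which [T (y k)] is, up to a
    small error, a vector [z k] supported in the same interval as [y k]; on the
    support of [y] the operator becomes a multiplier, with coefficients the
    ratios [lam] of coordinates.  For a set [A] of coordinates, the parts of [v]
    on [A] and off [A], and likewise the part of [v] on [A] and the part of its
    image off [A], cannot both be bounded below, since this would produce
    isomorphic subspaces with disjoint supports ([dichotomy]).  Thus
    on a smaller subspace either [v] nearly vanishes on [A], or both [v] and its
    image nearly vanish off [A] ([concentrate]).  Applied to the sets where [lam]
    lies in the cells of a fine net of a ball of scalars, this singles
    out one cell on which vectors and images are concentrated
    ([diagonal_eigenvalue]), and there the image is nearly [a] times the vector.

    Compactness of the bounded sets of scalars then provides one [a] and a block
    sequence [w] in the span of [x] with [T (w k) - a *: w k] of norm at most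
    [2^-1 ^+ k] times that of [w k] ([block_eigen_limit]).  With norming
    functionals [f k] biorthogonal to [w] ([biorthogonal]), the series of
    [f k v *: (T (w k) - a *: w k)] defines an operator [S] on the whole space
    that agrees with [T - a] on the closed span of [w].  It is strictly
    singular, because every infinite dimensional subspace meets the kernel of the
    first [m] functionals, where the norm of [S] is of order [2^-1 ^+ m]
    ([nuclear_strictly_singular]). *)

Set Implicit Arguments.
Unset Strict Implicit.
Unset Printing Implicit Defensive.

Import Order.TTheory GRing.Theory Num.Theory.
Import numFieldNormedType.Exports.

Local Open Scope classical_set_scope.
Local Open Scope ring_scope.

(** * Real and complex scalars *)

(** A common coordinate system for the two scalar fields: [imu] and [im] are
    zero when [K] is [R], and are the imaginary unit and part when [K] is
    [R[i]].  The law [re_dual] is what turns a real functional into a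
    [K]-linear one with that real part. *)
Record real_scalars (R : realType) (K : numFieldType) := RealScalars {
  emb : {rmorphism R -> K};
  re : K -> R;
  im : K -> R;
  imu : K;
  emb_le : forall r s, (emb r <= emb s) = (r <= s);
  ge0_emb : forall a : K, 0 <= a -> emb (re a) = a;
  re_emb : forall r, re (emb r) = r;
  reD : forall a b, re (a + b) = re a + re b;
  imD : forall a b, im (a + b) = im a + im b;
  reZ : forall r a, re (emb r * a) = r * re a;
  imZ : forall r a, im (emb r * a) = r * im a;
  re_imE : forall a, a = emb (re a) + imu * emb (im a);
  re_dual : forall a r s, re (a * (emb r - imu * emb s)) = re a * r + im a * s;
  re_le : forall a, emb `|re a| <= `|a|;
  im_le : forall a, emb `|im a| <= `|a|;
  imu_le1 : `|imu| <= 1 }.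

Lemma real_scalars_exist (R : realType) (K : numFieldType) :
  K = (R : numFieldType) \/ K = (R[i] : numFieldType) ->
  inhabited (real_scalars R K).
Proof.
case=> ->; constructor.
  by apply: (@RealScalars R R idfun id (fun=> 0) 0) => //= *;
    rewrite ?(mul0r, mulr0, subr0, addr0, normr0) ?ler01.
unshelve eapply (@RealScalars R (R[i] : numFieldType) (real_complex R : {rmorphism R -> R[i]})
  (@complex.Re R) (@complex.Im R) (Complex 0 1)).
- by move=> r s; rewrite lecR.
- by move=> [a b]; rewrite lecE /= => /andP[/eqP -> _].
- by [].
- by move=> [a b] [c d].
- by move=> [a b] [c d].
- by move=> r [a b] /=; rewrite mul0r subr0.
- by move=> r [a b] /=; rewrite mul0r addr0.
- by move=> [a b]; apply/eqP; rewrite eq_complex /=; apply/andP; split; apply/eqP; ring.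
- by move=> [a b] r s /=; ring.
- by move=> a; exact: normc_ge_Re.
- move=> [a b]; rewrite normc_def lecR /= -sqrtr_sqr.
  by rewrite ler_wsqrtr// lerDr sqr_ge0.
- by rewrite normc_def /= expr0n /= add0r expr1n sqrtr1.
Qed.

Section Norm.
Context {R : realType} {K : numFieldType} (Q : real_scalars R K).
Local Notation emb := (emb Q).

(** Modulus and norm are turned into elements of [R], where, unlike in [R[i]],
    the order is total and linear arithmetic applies. *)
Definition rho (a : K) : R := re Q `|a|.

Lemma emb_rho a : emb (rho a) = `|a|.
Proof. exact/ge0_emb/normr_ge0. Qed.

Lemma emb_lt r s : (emb r < emb s) = (r < s).
Proof. by rewrite !lt_neqAle emb_le (inj_eq (fmorph_inj _)). Qed.

Lemma embI : injective emb. Proof. exact: fmorph_inj. Qed.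

Lemma rho_ge0 a : 0 <= rho a.
Proof. by rewrite -(emb_le Q) emb_rho rmorph0 normr_ge0. Qed.

Lemma rhoM a b : rho (a * b) = rho a * rho b.
Proof. by apply: embI; rewrite rmorphM /= !emb_rho normrM. Qed.

Lemma rhoD a b : rho (a + b) <= rho a + rho b.
Proof. by rewrite -(emb_le Q) rmorphD /= !emb_rho ler_normD. Qed.

Lemma rho_emb r : rho (emb r) = `|r|.
Proof.
apply: embI; rewrite emb_rho.
have [r0|r0] := lerP 0 r.
  by rewrite !ger0_norm // -(rmorph0 emb) emb_le.
by rewrite !ltr0_norm ?rmorphN // -(rmorph0 emb) emb_lt.
Qed.

Lemma rho0 : rho 0 = 0.
Proof. by apply: embI; rewrite emb_rho normr0 rmorph0. Qed.

Lemma rho1 : rho 1 = 1.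
Proof. by apply: embI; rewrite emb_rho normr1 rmorph1. Qed.

Lemma rhoN a : rho (- a) = rho a.
Proof. by apply: embI; rewrite !emb_rho normrN. Qed.

Lemma rho_eq0 a : rho a = 0 -> a = 0.
Proof. by move=> h; apply/eqP; rewrite -normr_eq0 -emb_rho h rmorph0. Qed.

Lemma rho_gt0 a : a != 0 -> 0 < rho a.
Proof.
by move=> a0; rewrite lt_neqAle rho_ge0 andbT eq_sym; apply: contra a0 => /eqP/rho_eq0 ->.
Qed.

Lemma rhoV a : rho a^-1 = (rho a)^-1.
Proof.
have [->|a0] := eqVneq a 0; first by rewrite invr0 rho0 invr0.
have := rho_gt0 a0 => h.
apply: (mulfI (lt0r_neq0 h)); rewrite -rhoM !divff ?rho1 // lt0r_neq0//.
Qed.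

Lemma re_le_rho a : `|re Q a| <= rho a.
Proof. by rewrite -(emb_le Q) emb_rho re_le. Qed.

Lemma im_le_rho a : `|im Q a| <= rho a.
Proof. by rewrite -(emb_le Q) emb_rho im_le. Qed.

Lemma rho_imu : rho (imu Q) <= 1.
Proof. by rewrite -(emb_le Q) emb_rho rmorph1 imu_le1. Qed.

(** A grid of step [e / 2] on the real and on the imaginary part. *)
Lemma bounded_net (L e : R) : 0 < e ->
  exists s : seq K, forall a, rho a <= L -> exists2 b, b \in s & rho (a - b) <= e.
Proof.
move=> e0.
have e20 : 0 < e / 2 by lra.
pose n := (Num.truncn (2 * `|L| / (e / 2))).+1.
pose g (k : 'I_n) := - `|L| + k%:R * (e / 2).
have gP (r : R) : `|r| <= L -> exists k : 'I_n, `|r - g k| <= e / 2.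
  move=> rL; have := ler_norm L => LL; move: rL; rewrite ler_norml => /andP[r1 r2].
  have t0 : 0 <= (r + `|L|) / (e / 2) by apply: divr_ge0; lra.
  have tn : (Num.truncn ((r + `|L|) / (e / 2)) < n)%N.
    by rewrite ltnS le_truncn // ler_wpM2r ?invr_ge0; lra.
  exists (Ordinal tn); rewrite /g /=.
  have /andP[] := Num.Theory.truncn_itv t0.
  set k := Num.truncn _; rewrite ler_pdivlMr // ltr_pdivrMr // => h1 h2.
  have h3 : k.+1%:R * (e / 2) = k%:R * (e / 2) + e / 2 by rewrite -natr1 mulrDl mul1r.
  rewrite ler_norml; apply/andP; split; lra.
exists [seq emb (g k) + imu Q * emb (g l) | k <- enum 'I_n, l <- enum 'I_n] => a aL.
have [k hk] := gP _ (le_trans (re_le_rho a) aL).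
have [l hl] := gP _ (le_trans (im_le_rho a) aL).
exists (emb (g k) + imu Q * emb (g l)).
  by apply: allpairs_f; rewrite mem_enum.
have -> : a - (emb (g k) + imu Q * emb (g l)) =
    emb (re Q a - g k) + imu Q * emb (im Q a - g l).
  by rewrite {1}[a](re_imE Q) !rmorphB /=; ring.
apply: le_trans (rhoD _ _) _; rewrite rhoM !rho_emb.
have : rho (imu Q) * `|im Q a - g l| <= 1 * (e / 2).
  by apply: ler_pM; rewrite ?rho_ge0 ?rho_imu.
lra.
Qed.

(** Bolzano-Weierstrass for the real parts, then for the imaginary parts along
    the subsequence. *)
Lemma bounded_cluster (u : nat -> K) (L : R) : (forall n, rho (u n) <= L) ->
  exists a, forall e, 0 < e -> forall n0, exists2 n, (n0 <= n)%N & rho (u n - a) < e.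
Proof.
move=> uL.
have BW (v : nat -> R) : (forall n, `|v n| <= L) ->
    exists2 f : nat -> nat, increasing_seq f & cvgn (v \o f).
  move=> vL; apply: bolzano_weierstrass.
  exists L; split; first exact: num_real.
  by move=> x Lx /= n _; apply: le_trans (vL n) (ltW Lx).
have [f fi /cvg_ex[a /= fa]] := BW (re Q \o u) (fun n => le_trans (re_le_rho _) (uL n)).
have [g gi /cvg_ex[b /= gb]] := BW (im Q \o u \o f) (fun n => le_trans (im_le_rho _) (uL _)).
have incr (h : nat -> nat) : increasing_seq h -> forall n, (n <= h n)%N.
  move=> /increasing_seqP hi; elim=> // n IH.
  by apply: leq_ltn_trans IH _; have := hi n; rewrite ltEnat.
exists (emb a + imu Q * emb b) => e e0 n0.
have e20 : 0 < e / 2 by lra.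
move/cvgrPdist_lt : fa => /(_ _ e20)[n1 _ h1].
move/cvgrPdist_lt : gb => /(_ _ e20)[n2 _ h2].
pose n := maxn n0 (maxn n1 n2).
have nf : (n1 <= g n)%N.
  by apply: leq_trans (incr _ gi n); rewrite /n !leq_max leqnn !orbT.
have n2n : (n2 <= n)%N by rewrite /n !leq_max leqnn !orbT.
exists (f (g n)).
  apply: leq_trans (incr _ fi _); apply: leq_trans (incr _ gi _).
  by rewrite /n leq_max leqnn.
have := h1 _ nf; have := h2 _ n2n => /=.
rewrite distrC => {}h2; rewrite distrC => {}h1.
have -> : u (f (g n)) - (emb a + imu Q * emb b) =
    emb (re Q (u (f (g n))) - a) + imu Q * emb (im Q (u (f (g n))) - b).
  by rewrite {1}[u (f (g n))](re_imE Q) !rmorphB /=; ring.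
apply: le_lt_trans (rhoD _ _) _; rewrite rhoM !rho_emb.
have : rho (imu Q) * `|im Q (u (f (g n))) - b| <= 1 * `|im Q (u (f (g n))) - b|.
  by apply: ler_pM; rewrite ?rho_ge0 ?rho_imu.
lra.
Qed.

Lemma rho_cauchy_cvg (u : nat -> K) :
  (forall e, 0 < e -> exists n0, forall n, (n0 <= n)%N -> rho (u n - u n0) < e) ->
  exists a, forall e, 0 < e -> exists n0, forall n, (n0 <= n)%N -> rho (u n - a) < e.
Proof.
move=> uC; have [n1 h1] := uC _ ltr01.
have [|a ha] := @bounded_cluster (fun n => u (n1 + n)%N) (rho (u n1) + 1).
  move=> n; have := h1 _ (leq_addr n n1).
  have := rhoD (u (n1 + n)%N - u n1) (u n1); rewrite subrK; lra.
exists a => e e0; have e30 : 0 < e / 3 by lra.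
have [n2 h2] := uC _ e30; exists n2 => n n2n.
have [m mn hm] := ha _ e30 n2.
have := h2 _ n2n; have := h2 (n1 + m)%N (leq_trans mn (leq_addl _ _)).
have -> : u n - a = (u n - u n2) + ((u (n1 + m)%N - a) - (u (n1 + m)%N - u n2)) by ring.
have := rhoD (u n - u n2) ((u (n1 + m)%N - a) - (u (n1 + m)%N - u n2)).
have := rhoD (u (n1 + m)%N - a) (- (u (n1 + m)%N - u n2)); rewrite rhoN; lra.
Qed.

Context {X : completeNormedModType K}.
Implicit Types x y z : X.

Definition nrm x : R := re Q `|x|.
Local Notation N := nrm.

Lemma emb_nrm x : emb (N x) = `|x|.
Proof. exact/ge0_emb/normr_ge0. Qed.

Lemma nrm_ge0 x : 0 <= N x.
Proof. by rewrite -(emb_le Q) emb_nrm rmorph0 normr_ge0. Qed.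

Lemma nrmZ a x : N (a *: x) = rho a * N x.
Proof. by apply: embI; rewrite rmorphM /= emb_rho !emb_nrm normrZ. Qed.

Lemma nrmD x y : N (x + y) <= N x + N y.
Proof. by rewrite -(emb_le Q) rmorphD /= !emb_nrm ler_normD. Qed.

Lemma nrmN x : N (- x) = N x.
Proof. by apply: embI; rewrite !emb_nrm normrN. Qed.

Lemma nrmB x y : N (x - y) <= N x + N y.
Proof. by have := nrmD x (- y); rewrite nrmN. Qed.

Lemma nrmBC x y : N (x - y) = N (y - x).
Proof. by rewrite -nrmN opprB. Qed.

Lemma nrm_tri z x y : N (x - y) <= N (x - z) + N (z - y).
Proof. by have := nrmD (x - z) (z - y); rewrite addrA subrK. Qed.

Lemma nrm0 : N 0 = 0.
Proof. by apply: embI; rewrite emb_nrm normr0 rmorph0. Qed.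

Lemma nrm_eq0 x : N x = 0 -> x = 0.
Proof. by move=> h; apply/eqP; rewrite -normr_eq0 -emb_nrm h rmorph0. Qed.

Lemma nrm_gt0 x : x != 0 -> 0 < N x.
Proof.
by move=> a0; rewrite lt_neqAle nrm_ge0 andbT eq_sym; apply: contra a0 => /eqP/nrm_eq0 ->.
Qed.

Lemma nrm_small0 x : (forall e, 0 < e -> N x <= e) -> x = 0.
Proof.
move=> h; apply: nrm_eq0; apply/eqP; rewrite eq_le nrm_ge0 andbT.
by apply/ler_addgt0Pr => e e0; rewrite add0r h.
Qed.

Lemma nrm_sum (I : Type) (r : seq I) (P : pred I) (F : I -> X) :
  N (\sum_(i <- r | P i) F i) <= \sum_(i <- r | P i) N (F i).
Proof.
apply: (big_ind2 (fun x s => N x <= s)) => //; first by rewrite nrm0.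
by move=> x s y t xs yt; apply: le_trans (nrmD _ _) (lerD _ _).
Qed.

Definition ncvg (u : nat -> X) x :=
  forall e, 0 < e -> exists n0, forall n, (n0 <= n)%N -> N (u n - x) < e.

Lemma emb_pos (a : K) : 0 < a -> exists2 r, 0 < r & emb r = a.
Proof.
move=> a0; exists (re Q a); last exact/ge0_emb/ltW.
by rewrite -emb_lt rmorph0 ge0_emb // ltW.
Qed.

Lemma ncvgP (u : nat -> X) x : ncvg u x <-> (u @ \oo --> x).
Proof.
split=> [h|/cvgrPdist_lt h].
  apply/cvgrPdist_lt => a /emb_pos[r r0 <-].
  have [n0 hn] := h _ r0; exists n0 => // n /= n0n.
  by rewrite -emb_nrm emb_lt nrmBC hn.
move=> e e0; have : 0 < emb e by rewrite -(rmorph0 emb) emb_lt.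
move=> /h[n0 _ hn]; exists n0 => n n0n.
by have := hn _ n0n; rewrite /= -emb_nrm emb_lt nrmBC.
Qed.

Lemma ncvg_unique u x y : ncvg u x -> ncvg u y -> x = y.
Proof.
move=> hx hy; apply/eqP; rewrite -subr_eq0; apply/eqP/nrm_small0 => e e0.
have e20 : 0 < e / 2 by lra.
have [n1 h1] := hx _ e20; have [n2 h2] := hy _ e20.
have := h1 _ (leq_maxl n1 n2); have := h2 _ (leq_maxr n1 n2).
have := nrm_tri (u (maxn n1 n2)) x y; rewrite (nrmBC x (u _)); lra.
Qed.

Lemma nrm_complete (u : nat -> X) :
  (forall e, 0 < e -> exists n0, forall n, (n0 <= n)%N -> N (u n - u n0) < e) ->
  exists x, ncvg u x.
Proof.
move=> h; suff /cvg_ex[x ux] : cvg (u @ \oo) by exists x; exact/ncvgP.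
apply/cauchy_cvgP/cauchy_exP => a /emb_pos[r r0 <-].
have [n0 hn] := h _ r0; exists (u n0); exists n0 => // n /= n0n.
by rewrite -ball_normE /= -emb_nrm emb_lt nrmBC hn.
Qed.

Lemma ncvg_le (u : nat -> X) x (b : R) :
  ncvg u x -> (exists n0, forall n, (n0 <= n)%N -> N (u n) <= b) -> N x <= b.
Proof.
move=> ux [n1 ub]; apply/ler_addgt0Pr => e e0; have [n0 h] := ux _ e0.
have := h _ (leq_maxl n0 n1); have := ub _ (leq_maxr n0 n1).

have := nrmB (u (maxn n0 n1)) (u (maxn n0 n1) - x); rewrite subKr; lra.
Qed.

Lemma ncvg_lin a u v x y : ncvg u x -> ncvg v y ->
  ncvg (fun n => a *: u n + v n) (a *: x + y).
Proof. by rewrite !ncvgP => ux vy; apply: cvgD => //; apply: cvgZr. Qed.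

Lemma closureP (A : set X) x :
  closure A x <-> forall e, 0 < e -> exists2 a, A a & N (x - a) < e.
Proof.
split=> [h e e0|h B /nbhs_ballP[a /= /emb_pos[r r0 <-]] hB].
  have : 0 < emb e by rewrite -(rmorph0 emb) emb_lt.
  move=> /(nbhsx_ballx x)/h[a []]; rewrite -ball_normE /= => Aa.
  by rewrite -emb_nrm emb_lt => ?; exists a.
have [b Ab xb] := h _ r0; exists b; split=> //; apply: hB.
by rewrite -ball_normE /= -emb_nrm emb_lt.
Qed.

End Norm.
(** * Baire's theorem *)

Lemma half_pow_small (R : realType) (a e : R) : 0 < e ->
  exists k, a * 2^-1 ^+ k < e.
Proof.
move=> e0; pose n := (Num.truncn (`|a| / e)).+1; exists n.
have h1 : `|a| / e < n%:R by exact: truncnS_gt.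
have h2 : n%:R <= 2 ^+ n :> R by rewrite -natrX ler_nat ltnW // ltn_expl.
rewrite exprVn ltr_pdivrMr ?exprn_gt0 //.
move: h1; rewrite ltr_pdivrMr // => h1.
have : n%:R * e <= 2 ^+ n * e by rewrite ler_pM2r.
have := ler_norm a; rewrite [e * _]mulrC; lra.
Qed.

Lemma half_pow_sum (R : realType) n : \sum_(k < n) 2^-1 ^+ k.+1 = 1 - 2^-1 ^+ n :> R.
Proof.
elim: n => [|n IH]; first by rewrite big_ord0 expr0 subrr.
by rewrite big_ord_recr /= IH exprS; lra.
Qed.

Lemma half_pow_gt0 (R : realType) n : 0 < 2^-1 ^+ n :> R.
Proof. by rewrite exprn_gt0. Qed.

Section Complete.
Context {R : realType} {K : numFieldType} (Q : real_scalars R K).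
Context {X : completeNormedModType K}.
Local Notation N := (nrm Q).
Local Notation ncvg := (ncvg Q).
Local Notation rho := (rho Q).

Lemma geometric_cauchy (u : nat -> X) (a : R) :
  (forall k, N (u k.+1 - u k) <= a * 2^-1 ^+ k) ->
  forall m n, (m <= n)%N -> N (u n - u m) <= 2 * a * 2^-1 ^+ m.
Proof.
move=> ua m n mn; rewrite -(subnKC mn); move: (n - m)%N => k {mn n}.
have a0 : 0 <= a.
  by have := ua 0%N; rewrite expr0 mulr1; apply: le_trans; apply: nrm_ge0.
suff : N (u (m + k)%N - u m) <= 2 * a * (2^-1 ^+ m - 2^-1 ^+ (m + k)).
  have : 0 <= a * 2^-1 ^+ (m + k) by rewrite mulr_ge0 // ltW // half_pow_gt0.
  lra.
elim: k => [|k IH]; first by rewrite addn0 !subrr nrm0 mulr0.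
have := nrm_tri Q (u (m + k)%N) (u (m + k.+1)%N) (u m).
have := ua (m + k)%N; rewrite addnS exprS; lra.
Qed.

Lemma geometric_cvg (u : nat -> X) (a : R) :
  (forall k, N (u k.+1 - u k) <= a * 2^-1 ^+ k) ->
  exists2 x, ncvg u x & forall m, N (x - u m) <= 2 * a * 2^-1 ^+ m.
Proof.
move=> ua; have ug := geometric_cauchy ua.
have [x ux] : exists x, ncvg u x.
  apply: nrm_complete => e e0; have [k hk] := half_pow_small (2 * a) e0.
  by exists k => n kn; apply: le_lt_trans hk; apply: ug.
exists x => // m; rewrite nrmBC; apply: (@ncvg_le _ _ _ _ (fun n => u m - u n)).
  move=> e e0; have [n0 h] := ux _ e0; exists n0 => n /h hun.
  by rewrite opprB addrC addrA subrK nrmBC.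
by exists m => n mn; rewrite nrmBC; apply: ug.
Qed.

(** If no set of the cover were dense in a ball, balls could be shrunk so as to
    avoid the sets one after the other, and their common point would not be
    covered. *)
Lemma baire_cover (A : nat -> set X) : (forall x, exists m, A m x) ->
  exists m x0 (r : R), 0 < r /\ forall x, N (x - x0) < r ->
    forall e : R, 0 < e -> exists2 a, A m a & N (x - a) < e.
Proof.
move=> Acov; apply: contrapT => hn.
have step (t : nat * (X * R)) : exists y : X * R, 0 < t.2.2 ->
    [/\ 0 < y.2, N (y.1 - t.2.1) + y.2 <= t.2.2, y.2 <= t.2.2 / 2
      & forall a, A t.1 a -> y.2 < N (a - y.1)].
  case: t => m [x r] /=.
  have [r0|r0] := ltP 0 r; last by exists (0, 0).
  have : exists z, N (z - x) < r /\ exists2 e : R, 0 < e & forall a, A m a -> e <= N (z - a).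
    apply: contrapT => h; apply: hn; exists m, x, r; split=> // z zr e e0.
    apply: contrapT => h'; apply: h; exists z; split=> //; exists e => // a Aa.
    by rewrite leNgt; apply/negP => ?; apply: h'; exists a.
  move=> [z [zx [e e0 he]]].
  pose s := Num.min (e / 2) (Num.min (r - N (z - x)) (r / 2)).
  have s0 : 0 < s by rewrite !lt_min; apply/and3P; split; lra.
  have : s <= s by []; rewrite {2}/s !le_min => /and3P[s1 s2 s3].
  exists (z, s) => _ /=; split=> //; first by lra.
  by move=> a /he; rewrite nrmBC; lra.
have [f hf] := choice step.
pose b := fix b n := if n is m.+1 then f (m, b m) else (0 : X, 1 : R).
have bp n : 0 < (b n).2.
  by elim: n => [|n IH] /=; [exact: ltr01 | have [] := hf (n, b n) IH].
have bS n := hf (n, b n) (bp n).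
have br n : (b n).2 <= 2^-1 ^+ n.
  elim: n => [|n IH]; first by rewrite expr0.
  by have [_ _ + _] := bS n; rewrite /= exprS; lra.
have bm m k : N ((b (m + k)%N).1 - (b m).1) + (b (m + k)%N).2 <= (b m).2.
  elim: k => [|k IH]; first by rewrite addn0 subrr nrm0 add0r.
  have [_ + _ _] := bS (m + k)%N; rewrite addnS /=.
  have := nrm_tri Q (b (m + k)%N).1 (b (m + k).+1).1 (b m).1; rewrite /=; lra.
have [x bx hx] : exists2 x, ncvg (fun n => (b n).1) x & True.
  have [] // := @geometric_cvg (fun n => (b n).1) 1; last by move=> x; exists x.
  move=> k; rewrite mul1r; have := bm k 1%N; rewrite addn1.
  by have := br k; have := bp k.+1; lra.
have [m Am] := Acov x.
have [_ _ _ /(_ _ Am)] := bS m.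
apply/negP; rewrite -leNgt -/(b m.+1).
apply: (@ncvg_le _ _ _ _ (fun n => (b n).1 - (f (m, b m)).1)).
  move=> e e0; have [n0 h] := bx _ e0; exists n0 => n /h hun.
  by rewrite opprB addrA subrK.
exists m.+1 => n mn; have := bm m.+1 (n - m.+1)%N; rewrite subnKC //=.
by have := bp n; lra.
Qed.

End Complete.
(** * Coordinates with respect to a Schauder basis *)

Section Coordinates.
Context {R : realType} {K : numFieldType} (Q : real_scalars R K).
Context {X : completeNormedModType K} (e : nat -> X) (he : schauder_basis e).
Implicit Types (x y : X) (A : pred nat).
Local Notation N := (nrm Q).
Local Notation ncvg := (ncvg Q).
Local Notation rho := (rho Q).
Local Notation c := (basis_coord e).

Lemma is_expansionP x (a : nat -> K) :
  is_expansion e x a <-> ncvg (fun n => \sum_(i < n) a i *: e i) x.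
Proof.
rewrite ncvgP /is_expansion; suff -> : (fun n => \sum_(i < n) a i *: e i) =
  series (fun i => a i *: e i) by [].
by apply/funext => n; rewrite /series /= big_mkord.
Qed.

Lemma coord_expansion x : ncvg (fun n => \sum_(i < n) c x i *: e i) x.
Proof.
apply/is_expansionP; rewrite /basis_coord; case: xgetP => // h.
by have [a [ha _]] := he x; have := h a.
Qed.

Lemma coord_unique x (a : nat -> K) : ncvg (fun n => \sum_(i < n) a i *: e i) x -> c x = a.
Proof.
move=> /is_expansionP xa; have [b [_ hb]] := he x.
by rewrite -(hb _ xa); apply/esym/hb/is_expansionP/coord_expansion.
Qed.

Lemma coord_lin a x y i : c (a *: x + y) i = a * c x i + c y i.
Proof.
suff -> : c (a *: x + y) = fun i => a * c x i + c y i by [].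
apply: coord_unique.
rewrite (_ : (fun n => _) = fun n => a *: (\sum_(i < n) c x i *: e i) +
  \sum_(i < n) c y i *: e i); first by apply: ncvg_lin; exact: coord_expansion.
apply/funext => n; rewrite scaler_sumr -big_split /=.
by apply: eq_bigr => j _; rewrite scalerDl scalerA.
Qed.

Lemma coord_sum_e n (a : nat -> K) i :
  c (\sum_(j < n) a j *: e j) i = if (i < n)%N then a i else 0.
Proof.
suff -> : c (\sum_(j < n) a j *: e j) = fun i => if (i < n)%N then a i else 0 by [].
apply: coord_unique => r r0; exists n => m nm.
suff -> : \sum_(j < n) a j *: e j =
    \sum_(j < m) (if (j < n)%N then a j else 0) *: e j by rewrite subrr nrm0.
rewrite -!(big_mkord xpredT (fun j => (if (j < n)%N then a j else 0) *: e j)).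
rewrite (big_cat_nat (n := n)) //= [X in _ + X]big1_seq ?addr0.
  by rewrite big_mkord; apply: eq_bigr => j _; rewrite ltn_ord.
by move=> j /andP[_]; rewrite mem_index_iota leqNgt => /andP[/negPf -> _]; rewrite scale0r.
Qed.

Lemma coord0 i : c 0 i = 0.
Proof. by have := coord_sum_e 0 (fun=> 0) i; rewrite big_ord0. Qed.

Lemma coordZ a x i : c (a *: x) i = a * c x i.
Proof. by have := coord_lin a x 0 i; rewrite coord0 !addr0. Qed.

Lemma coordD x y i : c (x + y) i = c x i + c y i.
Proof. by have := coord_lin 1 x y i; rewrite scale1r mul1r. Qed.

Lemma coordN x i : c (- x) i = - c x i.
Proof. by rewrite -scaleN1r coordZ mulN1r. Qed.

Lemma coordB x y i : c (x - y) i = c x i - c y i.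
Proof. by rewrite coordD coordN. Qed.

Lemma coord_sum (I : Type) (r : seq I) (P : pred I) (F : I -> X) i :
  c (\sum_(k <- r | P k) F k) i = \sum_(k <- r | P k) c (F k) i.
Proof.
apply: (big_ind2 (fun x s => c x i = s)) => //; first exact: coord0.
by move=> x s y t <- <-; rewrite coordD.
Qed.

Lemma coord_inj x y : c x =1 c y -> x = y.
Proof.
move=> /funext h; apply: ncvg_unique (coord_expansion x) _.
by rewrite h; exact: coord_expansion.
Qed.

Lemma basis_neq0 i : e i != 0.
Proof.
apply/eqP => ei0; have := coord_sum_e i.+1 (fun j => (j == i)%:R) i.
rewrite ltnSn eqxx big1 ?coord0; first by move/esym/eqP; rewrite oner_eq0.
move=> [j /= _] _; case: eqP => [->|]; by rewrite ?ei0 ?scaler0 ?scale0r.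
Qed.

Definition trunc_proj A n x : X := \sum_(i < n) (if A i then c x i else 0) *: e i.
Definition partial_sum n x : X := trunc_proj xpredT n x.
Local Notation pr := trunc_proj.
Local Notation ps := partial_sum.

Lemma coord_pr A n x i : c (pr A n x) i = if (i < n)%N && A i then c x i else 0.
Proof. by rewrite /trunc_proj (coord_sum_e n (fun j => if A j then c x j else 0)); case: ltnP. Qed.

Lemma coord_ps n x i : c (ps n x) i = if (i < n)%N then c x i else 0.
Proof. by rewrite coord_pr andbT. Qed.

Lemma psZ n a x : ps n (a *: x) = a *: ps n x.
Proof.
by apply: coord_inj => i; rewrite coordZ !coord_ps coordZ; case: ifP; rewrite // mulr0.
Qed.

Lemma psB n x y : ps n (x - y) = ps n x - ps n y.
Proof.
by apply: coord_inj => i; rewrite coordB !coord_ps coordB; case: ifP; rewrite // subr0.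
Qed.

Lemma psS n x : ps n.+1 x - ps n x = c x n *: e n.
Proof. by rewrite /partial_sum /trunc_proj big_ord_recr /= addrAC subrr add0r. Qed.

Lemma ps_cvg x : ncvg (fun n => ps n x) x.
Proof. exact: coord_expansion. Qed.

(** By Baire's theorem the vectors with partial sums bounded by some [m] are
    dense in a ball; differences of two such vectors approximate all small
    vectors, and scaling reaches all vectors. *)
Lemma ps_bounded_dense : exists M : R, forall x, exists a : X,
  (forall n, N (ps n a) <= M * N x) /\ N (x - a) <= N x / 2.
Proof.
pose A (m : nat) : set X := [set x | forall n, N (ps n x) <= m%:R].
(* The partial sums of one vector are bounded because they converge. *)
have [|m [x0 [r [r0 hr]]]] := @baire_cover _ _ Q _ A.
  move=> x; have [n0 hn0] := ps_cvg x ltr01.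
  pose B := N x + 1 + \sum_(k < n0) N (ps k x).
  exists (Num.truncn B).+1 => n /=.
  apply: le_trans (ltW (truncnS_gt B)); rewrite /B.
  have S0 k : 0 <= \sum_(j < k) N (ps j x) by apply: sumr_ge0 => *; exact: nrm_ge0.
  have [nn|nn] := ltnP n n0.
    rewrite (bigD1 (Ordinal nn)) //=.
    have : 0 <= \sum_(j < n0 | j != Ordinal nn) N (ps j x).
      by apply: sumr_ge0 => *; exact: nrm_ge0.
    by have := nrm_ge0 Q x; lra.
  have := hn0 _ nn; have := S0 n0.
  by have := nrmD Q (ps n x - x) x; rewrite subrK; lra.
pose M : R := 4 * m%:R / r; exists M => x.
have [->|xn0] := eqVneq x 0.
  exists 0; rewrite subrr nrm0 mulr0 mul0r; split=> // n.
  by rewrite -(scale0r (0 : X)) psZ scale0r nrm0.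
have x0' := nrm_gt0 Q xn0.
pose t : R := r / (2 * N x).
have t0 : 0 < t by rewrite divr_gt0 // mulr_gt0.
have tx : t * N x = r / 2 by rewrite /t; field; rewrite lt0r_neq0.
have d0 : 0 < t * N x / 4 by rewrite tx; lra.
have emb0 : emb Q t != 0 by rewrite fmorph_eq0 lt0r_neq0.
have [|a Aa xa] := hr (x0 + emb Q t *: x) _ _ d0.
  by rewrite addrC addKr nrmZ rho_emb gtr0_norm // tx; lra.
have [|b Ab xb] := hr x0 _ _ d0; first by rewrite subrr nrm0.
exists ((emb Q t)^-1 *: (a - b)).
have rt : rho (emb Q t)^-1 = t^-1 by rewrite rhoV rho_emb gtr0_norm.
split.
  move=> n; rewrite psZ psB nrmZ rt.
  have := Aa n; have := Ab n; have := nrmB Q (ps n a) (ps n b) => h1 h2 h3.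
  have -> : M * N x = t^-1 * (2 * m%:R).
    by rewrite /M /t; field; rewrite !lt0r_neq0.
  rewrite ler_wpM2l ?invr_ge0; lra.
have -> : x - (emb Q t)^-1 *: (a - b) =
    (emb Q t)^-1 *: ((x0 + emb Q t *: x - a) - (x0 - b)).
  rewrite opprB [b - x0]addrC addrACA [x0 + _]addrC addrK [- a + b]addrC.
  by rewrite -[b - a]opprB [in RHS]scalerBr scalerA mulVf // scale1r.
rewrite nrmZ rt; have := nrmB Q (x0 + emb Q t *: x - a) (x0 - b) => h.
have -> : N x / 2 = t^-1 * (t * N x / 2) by field; rewrite lt0r_neq0.
rewrite ler_wpM2l ?invr_ge0; lra.
Qed.

End Coordinates.
(** * Linear algebra: combinations of sequences, infinite dimension *)

Section LinearAlgebra.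
Context {K : fieldType} {V W : lmodType K}.
Implicit Types (y : nat -> V) (t : nat -> K) (U : set V).

Definition subspace U := U 0 /\ forall a u v, U u -> U v -> U (a *: u + v).

Lemma subspaceZ U a u : subspace U -> U u -> U (a *: u).
Proof. by move=> [U0 Ul] Uu; rewrite -[_ *: _]addr0; apply: Ul. Qed.

Lemma subspaceD U u v : subspace U -> U u -> U v -> U (u + v).
Proof. by move=> [U0 Ul] Uu Uv; rewrite -[u]scale1r; apply: Ul. Qed.

Lemma subspaceB U u v : subspace U -> U u -> U v -> U (u - v).
Proof. by move=> [U0 Ul] Uu Uv; rewrite addrC -scaleN1r; apply: Ul. Qed.

Lemma subspace_sum U (I : Type) (r : seq I) (P : pred I) (F : I -> V) :
  subspace U -> (forall i, P i -> U (F i)) -> U (\sum_(i <- r | P i) F i).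
Proof.
move=> sU UF; apply: (big_ind U) => //; first exact: sU.1.
by move=> u v; apply: subspaceD.
Qed.

Definition linear_on U (F : V -> W) :=
  forall a u v, U u -> U v -> F (a *: u + v) = a *: F u + F v.

Lemma linear_on0 U F : subspace U -> linear_on U F -> F 0 = 0.
Proof.
move=> sU lF; have /eqP := lF 1 0 0 sU.1 sU.1.
by rewrite !scale1r addr0 -subr_eq0 opprD addrA subrr sub0r oppr_eq0 => /eqP.
Qed.

Lemma linear_onZ U F a u : subspace U -> linear_on U F -> U u -> F (a *: u) = a *: F u.
Proof.
by move=> sU lF Uu; rewrite -[a *: u]addr0 lF ?(linear_on0 sU lF) ?addr0 //; exact: sU.1.
Qed.

Lemma linear_onB U F u v : subspace U -> linear_on U F -> U u -> U v ->
  F (u - v) = F u - F v.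
Proof.
move=> sU lF Uu Uv; rewrite addrC -scaleN1r lF // scaleN1r addrC //.
Qed.

Lemma linear_on_sum U F (I : Type) (r : seq I) (P : pred I) (G : I -> V) :
  subspace U -> linear_on U F -> (forall i, P i -> U (G i)) ->
  F (\sum_(i <- r | P i) G i) = \sum_(i <- r | P i) F (G i).
Proof.
move=> sU lF UG; elim: r => [|i r IH]; first by rewrite !big_nil (linear_on0 sU lF).
rewrite !big_cons; case: ifP => // Pi.
have UG' : U (\sum_(j <- r | P j) G j) by apply: subspace_sum.
by have := lF 1 _ _ (UG i Pi) UG'; rewrite !scale1r IH.
Qed.

Definition comb y t n : V := \sum_(k < n) t k *: y k.

Definition free_seq y := forall t n, comb y t n = 0 -> forall k, (k < n)%N -> t k = 0.

Definition span_seq y : set V := [set v | exists t n, v = comb y t n].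

Lemma comb_widen y t n m : (n <= m)%N ->
  comb y t n = comb y (fun k => if (k < n)%N then t k else 0) m.
Proof.
move=> nm; rewrite /comb.
rewrite -(big_mkord xpredT (fun k => (if (k < n)%N then t k else 0) *: y k)).
rewrite (big_cat_nat (n := n)) //= [X in _ + X]big1_seq ?addr0.
  by rewrite big_mkord; apply: eq_bigr => j _; rewrite ltn_ord.
by move=> j /andP[_]; rewrite mem_index_iota leqNgt => /andP[/negPf -> _]; rewrite scale0r.
Qed.

Lemma comb_lin y a t s n :
  comb y (fun k => a * t k + s k) n = a *: comb y t n + comb y s n.
Proof.
rewrite /comb scaler_sumr -big_split /=; apply: eq_bigr => k _.
by rewrite scalerDl scalerA.
Qed.

Lemma span_seq_subspace y : subspace (span_seq y).
Proof.
split; first by exists (fun=> 0), 0%N; rewrite /comb big_ord0.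
move=> a _ _ [t [n ->]] [s [m ->]].
rewrite (comb_widen y t (leq_maxl n m)) (comb_widen y s (leq_maxr n m)) -comb_lin.
by eexists; eexists.
Qed.

Lemma span_seq_mem y k : span_seq y (y k).
Proof.
exists (fun j => (j == k)%:R), k.+1; rewrite /comb big_ord_recr /= eqxx scale1r big1 ?add0r//.
by move=> i _; rewrite ltn_eqF ?scale0r.
Qed.

Lemma span_seq_min y U : subspace U -> (forall k, U (y k)) -> span_seq y `<=` U.
Proof.
move=> sU Uy _ [t [n ->]]; apply: subspace_sum => // i _; exact: subspaceZ.
Qed.

End LinearAlgebra.

Section Spans.
Context {K : numFieldType} {X : normedModType K}.
Implicit Types (A V : set X).

Lemma lin_span_min A V : subspace V -> A `<=` V -> lin_span A `<=` V.
Proof.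
move=> sV AV _ [n [c [v [Av ->]]]]; apply: subspace_sum => // i _.
by apply: subspaceZ => //; apply: AV.
Qed.

Lemma lin_span_mem A x : A x -> lin_span A x.
Proof.
by move=> Ax; exists 1%N, (fun=> 1), (fun=> x); split=> //; rewrite big_ord1 scale1r.
Qed.

Lemma lin_span_subspace A : subspace (lin_span A).
Proof.
split.
  by exists 0%N, (fun=> 0), (fun=> 0); split; [case|rewrite big_ord0].
move=> a _ _ [n [c [u [Au ->]]]] [m [d [v [Av ->]]]].
exists (n + m)%N, (fun i => match fintype.split i with inl j => a * c j | inr j => d j end),
  (fun i => match fintype.split i with inl j => u j | inr j => v j end); split.
  by move=> i; case: (fintype.split i).
rewrite big_split_ord scaler_sumr; congr (_ + _); apply: eq_bigr => i _.
  by rewrite (unsplitK (inl i)) scalerA.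
by rewrite (unsplitK (inr i)).
Qed.

Lemma lin_span_range (y : nat -> X) : lin_span (range y) = span_seq y.
Proof.
apply/seteqP; split.
  by apply: lin_span_min; [exact: span_seq_subspace | move=> _ [k _ <-]; exact: span_seq_mem].
apply: span_seq_min; first exact: lin_span_subspace.
by move=> k; apply: lin_span_mem; exists k.
Qed.

Lemma lin_span_seqP (s : seq X) x : lin_span [set` s] x ->
  exists b : 'I_(size s) -> K, x = \sum_(j < size s) b j *: s`_j.
Proof.
move: x; apply: lin_span_min.
  split; first by exists (fun=> 0); rewrite big1 // => j _; rewrite scale0r.
  move=> a _ _ [b ->] [d ->]; exists (fun j => a * b j + d j).
  by rewrite scaler_sumr -big_split /=; apply: eq_bigr => j _; rewrite scalerDl scalerA.
move=> x /= xs; have xi : (index x s < size s)%N by rewrite index_mem.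
exists (fun j => (j == Ordinal xi)%:R); rewrite (bigD1 (Ordinal xi)) //= eqxx scale1r.
by rewrite nth_index // big1 ?addr0 // => j /negPf ->; rewrite scale0r.
Qed.

(** More vectors than generators: the coefficient matrix has a left kernel. *)
Lemma free_seq_infinite_dim (y : nat -> X) (V : set X) :
  free_seq y -> (forall k, V (y k)) -> infinite_dim V.
Proof.
move=> fy Vy [s Vs]; pose m := size s.
have /choice[b hb] : forall k, exists b : 'I_m -> K, y k = \sum_(j < m) b j *: s`_j.
  by move=> k; apply: lin_span_seqP; apply: Vs.
pose A : 'M[K]_(m.+1, m) := \matrix_(k, j) b k j.
have : kermx A != 0.
  rewrite -mxrank_eq0 mxrank_ker -lt0n subn_gt0 ltnS; exact: rank_leq_col.
move=> /rowV0Pn[u /sub_kermxP uA]; case/rV0Pn=> k; apply/negP; rewrite negbK; apply/eqP.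
have /fy : comb y (fun k => u 0 (inord k)) m.+1 = 0.
  rewrite /comb (eq_bigr (fun k : 'I_m.+1 => \sum_(j < m) (u 0 k * A k j) *: s`_j)).
    rewrite exchange_big big1 //= => j _; rewrite -scaler_suml.
    by have /rowP/(_ j) := uA; rewrite !mxE => ->; rewrite scale0r.
  move=> i _; rewrite inord_val hb scaler_sumr; apply: eq_bigr => j _.
  by rewrite !mxE scalerA.
by move=> /(_ k (ltn_ord k)); rewrite inord_val.
Qed.

(** Induction on the number of functionals: the kernel of the last one has
    codimension at most one in [V], so it is again infinite dimensional. *)
Lemma common_kernel (V : set X) (f : nat -> X -> K) n : subspace V -> infinite_dim V ->
  (forall k, (k < n)%N -> linear_on V (f k : X -> K^o)) ->
  exists v, [/\ V v, v != 0 & forall k, (k < n)%N -> f k v = 0].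
Proof.
elim: n V => [|n IH] V sV iV lf.
  apply: contrapT => h; apply: iV; exists [::] => v Vv.
  have -> : v = 0 by apply: contrapT => /eqP v0; apply: h; exists v; split.
  exact: (lin_span_subspace _).1.
pose V' := V `&` [set v | f n v = 0].
have lfn := lf _ (ltnSn n).
have sV' : subspace V'.
  split; first by split; [exact: sV.1 | exact: linear_on0 sV lfn].
  move=> a u v [Vu /= fu] [Vv /= fv]; split; first exact: sV.2.
  by rewrite /= lfn // fu fv scaler0 addr0.
have [h|iV'] := pselect (exists s : seq X, V' `<=` lin_span [set` s]).
  have [v0 Vv0 fv0] : exists2 v0, V v0 & f n v0 != 0.
    apply: contrapT => h'; apply: iV; have [s hs] := h; exists s => v Vv.
    apply: hs; split=> //=; apply: contrapT => /eqP fv; apply: h'; by exists v.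
  exfalso; apply: iV; have [s hs] := h; exists (v0 :: s) => v Vv.
  pose a := f n v / f n v0.
  have V'v : V' (v - a *: v0).
    split; first by apply: subspaceB => //; exact: subspaceZ.
    rewrite /= (linear_onB sV lfn) //; last exact: subspaceZ.
    by rewrite (linear_onZ _ sV lfn) // /a /GRing.scale /= divfK // subrr.
  rewrite -[v](subrK (a *: v0)).
  have sS := lin_span_subspace [set` v0 :: s].
  apply: subspaceD => //.
    move: (hs _ V'v); apply: lin_span_min => // w /= ws; apply: lin_span_mem => /=.
    by rewrite in_cons ws orbT.
  by apply: subspaceZ => //; apply: lin_span_mem; rewrite /= mem_head.
have [|v [[Vv fv] v0 hv]] := IH V' sV' iV'.
  by move=> k kn a u v [Vu _] [Vv _]; apply: lf => //; rewrite ltnS ltnW.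
exists v; split=> // k; rewrite ltnS leq_eqVlt => /orP[/eqP -> //|]; exact: hv.
Qed.

End Spans.
(** * The basis constant and block sequences *)

Section BasisConstant.
Context {R : realType} {K : numFieldType} (Q : real_scalars R K).
Context {X : completeNormedModType K} (e : nat -> X) (he : schauder_basis e).
Implicit Types (x z : X) (y : nat -> X) (A : pred nat).
Local Notation N := (nrm Q).
Local Notation ncvg := (ncvg Q).
Local Notation rho := (rho Q).
Local Notation c := (basis_coord e).
Local Notation ps := (partial_sum e).
Local Notation pr := (trunc_proj e).

(** As in the open mapping theorem, [x] is an absolutely convergent series of
    vectors [f (xs k)] with controlled partial sums.  For fixed [m] the [m]-th
    partial sums of these vectors add up to some [q m]; the [q m] are the partial
    sums of an expansion that converges to [x], and uniqueness of the expansion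
    makes [q m] the [m]-th partial sum of [x]. *)
Lemma ps_bounded : exists2 C : R, 1 <= C & forall n x, N (ps n x) <= C * N x.
Proof.
have [M0 /choice[f hf]] := ps_bounded_dense Q he.
pose M := Num.max 0 M0.
have M_ge0 : 0 <= M by rewrite /M le_max lexx.
have f1 x n : N (ps n (f x)) <= M * N x.
  apply: le_trans ((hf x).1 n) _; rewrite ler_wpM2r ?nrm_ge0 //.
  by rewrite /M le_max lexx orbT.
have f2 x := (hf x).2.
exists (1 + 2 * M) => [|n x]; first by lra.
pose xs k := iter k (fun z => z - f z) x.
pose s k := \sum_(j < k) f (xs j).
have xsE k : x - s k = xs k.
  elim: k => [|k IH]; first by rewrite /s big_ord0 subr0.
  by rewrite /s big_ord_recr /= opprD addrA IH.
have xs_le k : N (xs k) <= N x * 2^-1 ^+ k.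
  elim: k => [|k IH]; first by rewrite expr0 mulr1.
  by rewrite exprS /=; have := f2 (xs k); lra.
have ps_s m k : ps m (s k.+1) - ps m (s k) = ps m (f (xs k)).
  by rewrite -(psB Q he) /s big_ord_recr /= addrAC subrr add0r.
have /choice[q hq] : forall m, exists q, ncvg (fun k => ps m (s k)) q /\
    forall k, N (q - ps m (s k)) <= 2 * (M * N x) * 2^-1 ^+ k.
  move=> m; have [|q q1 q2] := @geometric_cvg _ _ Q X (fun k => ps m (s k)) (M * N x).
    move=> k; rewrite ps_s; apply: le_trans (f1 _ _) _.
    by rewrite -mulrA ler_wpM2l.
  by exists q.
(* A limit of multiples of [e m] is a multiple of [e m]. *)
have /choice[b hb] : forall m, exists b, q m.+1 - q m = b *: e m.
  move=> m; have em := nrm_gt0 Q (basis_neq0 Q he m).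
  have dif : ncvg (fun k => c (s k) m *: e m) (q m.+1 - q m).
    have := ncvg_lin (-1) (hq m).1 (hq m.+1).1.
    rewrite scaleN1r addrC; congr (ncvg _ _); apply/funext => k.
    by rewrite scaleN1r addrC psS.
  have [|b hb] := @rho_cauchy_cvg _ _ Q (fun k => c (s k) m).
    move=> d d0; have d1 : 0 < d * N (e m) / 2 by rewrite divr_gt0 // mulr_gt0.
    have [k0 hk] := dif _ d1; exists k0 => k kk.
    rewrite -(ltr_pM2r em) -nrmZ scalerBl.
    apply: le_lt_trans (nrm_tri Q (q m.+1 - q m) _ _) _.
    by have := hk _ kk; have := hk _ (leqnn k0); rewrite (nrmBC Q (q m.+1 - q m)); lra.
  exists b; apply: (ncvg_unique dif) => d d0.
  have d1 : 0 < d / N (e m) by rewrite divr_gt0.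
  have [k0 hk] := hb _ d1; exists k0 => k /hk.
  by rewrite -scalerBl nrmZ ltr_pdivlMr.
have qE m : q m = \sum_(i < m) b i *: e i.
  elim: m => [|m IH]; last by rewrite big_ord_recr /= -IH -hb addrC subrK.
  rewrite big_ord0; apply: (ncvg_unique (hq 0%N).1) => d d0; exists 0%N => k _.
  by rewrite /partial_sum /trunc_proj big_ord0 subrr nrm0.
have q_cvg : ncvg q x.
  move=> d d0; have d2 : 0 < d / 2 by lra.
  have [k hk] := half_pow_small (2 * (M * N x) + N x) d2.
  have [n0 hn] := ps_cvg Q he (s k) d2; exists n0 => m /hn h1.
  have := nrm_tri Q (ps m (s k)) (q m) x.
  have := nrm_tri Q (s k) (ps m (s k)) x.
  have := (hq m).2 k; have := xs_le k; rewrite -xsE (nrmBC Q x); lra.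
have cx : c x = b.
  apply: (@coord_unique _ _ Q) => // d /q_cvg[k hk].
  by exists k => m /hk; rewrite qE.
have -> : ps n x = q n by rewrite qE -cx.
have := (hq n).2 0%N; rewrite expr0 mulr1 /s big_ord0.
rewrite -[X in ps n X](scale0r (0 : X)) (psZ Q he) scale0r subr0.
by have := nrm_ge0 Q x; lra.
Qed.

Definition supported m n x := forall i, ~~ (m <= i < n)%N -> c x i = 0.

Lemma supported_subspace m n : subspace (supported m n).
Proof.
split=> [i _|a u v hu hv i hi]; first exact: (coord0 Q he).
by rewrite (coord_lin Q he) hu // hv // mulr0 addr0.
Qed.

Lemma supportedW m n m' n' x : (m' <= m)%N -> (n <= n')%N ->
  supported m n x -> supported m' n' x.
Proof.
move=> mm nn h i hi; apply: h; apply: contra hi => /andP[h1 h2].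
by rewrite (leq_trans mm h1) (leq_trans h2 nn).
Qed.

Lemma supported_ps n x : supported 0 n x -> ps n x = x.
Proof.
move=> h; apply: (coord_inj Q he) => i; rewrite (coord_ps Q he).
by case: ifP => // ni; rewrite h // ni.
Qed.

Lemma supported_ps_diff m n x : (m <= n)%N -> supported m n (ps n x - ps m x).
Proof.
move=> mn i; rewrite (coordB Q he) !(coord_ps Q he).
case: (ltnP i m) => im /=; first by rewrite (leq_trans im mn) subrr.
by move/negPf ->; rewrite subrr.
Qed.

Definition blocks (p : nat -> nat) (y : nat -> X) :=
  forall k, (p k <= p k.+1)%N /\ supported (p k) (p k.+1) (y k).

Lemma blocks_mono p y : blocks p y -> {homo p : m n / (m <= n)%N}.
Proof. by move=> hp; apply: homo_leq => // [m n l|k]; [exact: leq_trans | exact: (hp k).1]. Qed.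

Lemma blocks_coord0 p y k l i : blocks p y -> (p k <= i < p k.+1)%N -> l != k ->
  c (y l) i = 0.
Proof.
move=> hp /andP[ki ik] lk; apply: (hp l).2; apply/negP => /andP[li il].
have mono := blocks_mono hp; move: lk; rewrite neq_ltn => /orP[lk|kl].
  by have := leq_trans il (leq_trans (mono _ _ lk) ki); rewrite ltnn.
by have := leq_trans ik (leq_trans (mono _ _ kl) li); rewrite ltnn.
Qed.

Lemma blocks_comb_coord p y t n k i : blocks p y -> (p k <= i < p k.+1)%N ->
  c (comb y t n) i = if (k < n)%N then t k * c (y k) i else 0.
Proof.
move=> hp ki; rewrite (coord_sum Q he); case: ltnP => kn.
  rewrite (bigD1 (Ordinal kn)) //= (coordZ Q he) big1 ?addr0 // => j jk.
  by rewrite (coordZ Q he) (blocks_coord0 hp ki) ?mulr0.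
rewrite big1 // => j _; rewrite (coordZ Q he) (blocks_coord0 hp ki) ?mulr0 //.
by rewrite ltn_eqF // (leq_trans (ltn_ord j)).
Qed.

Lemma comb_supported p y t n : blocks p y -> supported 0 (p n) (comb y t n).
Proof.
move=> hp; apply: subspace_sum => [|k _]; first exact: supported_subspace.
apply: (subspaceZ _ (supported_subspace _ _)).
apply: supportedW (hp k).2 => //; exact: (blocks_mono hp).
Qed.

Context (C : R) (C1 : 1 <= C) (hC : forall n x, N (ps n x) <= C * N x).

Lemma ps_diff_le m n x : N (ps n x - ps m x) <= 2 * C * N x.
Proof. by have := nrmB Q (ps n x) (ps m x); have := hC n x; have := hC m x; lra. Qed.

Lemma coord_le x i : rho (c x i) * N (e i) <= 2 * C * N x.
Proof. by rewrite -nrmZ -psS ps_diff_le. Qed.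

Lemma coord_closed x i :
  (forall d : R, 0 < d -> exists2 z, c z i = 0 & N (x - z) < d) -> c x i = 0.
Proof.
move=> h; have ei := nrm_gt0 Q (basis_neq0 Q he i).
apply/(rho_eq0 (Q := Q))/eqP; rewrite eq_le rho_ge0 andbT -(ler_pM2r ei) mul0r.
apply/ler_addgt0Pr => d d0; rewrite add0r.
have C1' := C1; have d1 : 0 < d / (2 * C) by rewrite divr_gt0 //; lra.
have [z zi xz] := h _ d1.
have := coord_le (x - z) i; rewrite (coordB Q he) zi subr0.
by move: xz; rewrite ltr_pdivlMr; lra.
Qed.

(** The term [t k *: y k] is a difference of two partial sums of the combination. *)
Lemma block_coef p y t n k : blocks p y -> (k < n)%N ->
  rho (t k) * N (y k) <= 2 * C * N (comb y t n).
Proof.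
move=> hp kn; rewrite -nrmZ.
suff -> : t k *: y k = ps (p k.+1) (comb y t n) - ps (p k) (comb y t n).
  exact: ps_diff_le.
apply: (coord_inj Q he) => i; rewrite (coordB Q he) (coordZ Q he) !(coord_ps Q he).
have [pk sk] := hp k.
have [ki|] := boolP (p k <= i < p k.+1)%N.
  rewrite (blocks_comb_coord _ _ hp ki) kn; case/andP: ki => ki ->.
  by rewrite ltnNge ki subr0.
move=> h; rewrite sk // mulr0; case: (ltnP i (p k)) => ik.
  by rewrite (leq_trans ik pk) subrr.
by move: h; rewrite ik /= => /negPf ->; rewrite subr0.
Qed.

Lemma block_free p y : blocks p y -> (forall k, y k != 0) -> free_seq y.
Proof.
move=> hp y0 t n yt k kn; have := block_coef t hp kn; rewrite yt nrm0 mulr0.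
rewrite pmulr_lle0 ?nrm_gt0 // => h; apply: (rho_eq0 (Q := Q)).
by apply/eqP; rewrite eq_le h rho_ge0.
Qed.

Lemma block_perturbation p y (r : nat -> X) (d : nat -> R) t n : blocks p y ->
  (forall k, 0 <= d k) -> (forall k, N (r k) <= d k * N (y k)) ->
  N (comb r t n) <= 2 * C * (\sum_(k < n) d k) * N (comb y t n).
Proof.
move=> hp d0 hr; apply: le_trans (nrm_sum _ _ _ _) _.
rewrite mulrAC mulr_sumr; apply: ler_sum => k _; rewrite nrmZ.
have := block_coef t hp (ltn_ord k) => h.
apply: le_trans (ler_wpM2l (rho_ge0 _ _) (hr k)) _.
by rewrite mulrCA mulrC ler_wpM2r.
Qed.

End BasisConstant.
(** * Equivalent sequences have isomorphic closed spans *)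

Section ClosedSpans.
Context {R : realType} {K : numFieldType} (Q : real_scalars R K).
Context {X : completeNormedModType K}.
Implicit Types (x u v : X) (y z : nat -> X) (V : set X).
Local Notation N := (nrm Q).
Local Notation ncvg := (ncvg Q).
Local Notation rho := (rho Q).

Lemma closure_subspace V : subspace V -> subspace (closure V).
Proof.
move=> sV; split; first exact: subset_closure sV.1.
move=> a u v /(closureP Q) hu /(closureP Q) hv; apply/(closureP Q) => d d0.
have ra := rho_ge0 Q a.
have d1 : 0 < d / (2 * (rho a + 1)) by rewrite divr_gt0 // mulr_gt0 //; lra.
have d2 : 0 < d / 2 by lra.
have [u' Vu' uu'] := hu _ d1; have [v' Vv' vv'] := hv _ d2.
exists (a *: u' + v'); first exact: sV.2.
rewrite opprD addrACA -scalerBr; apply: le_lt_trans (nrmD _ _ _) _; rewrite nrmZ.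
have : rho a * N (u - u') <= (rho a + 1) * N (u - u').
  by rewrite ler_wpM2r ?nrm_ge0 //; lra.
by move: uu'; rewrite ltr_pdivlMr; lra.
Qed.

Lemma closed_subspaceP V : closed_subspace V <-> closed V /\ subspace V.
Proof.
split=> [[cV [V0 Vl]]|[cV [V0 Vl]]]; split=> //.
  split; first by move: V0; rewrite in_setE.
  by move=> a u v Vu Vv; have := Vl a u v; rewrite !in_setE; apply.
split; first by rewrite in_setE.
by move=> a u v; rewrite !in_setE; exact: Vl.
Qed.

Lemma closed_spanE y : closed_span y = closure (span_seq y).
Proof. by rewrite /closed_span lin_span_range. Qed.

Lemma closed_span_closed_subspace y : closed_subspace (closed_span y).
Proof.
apply/closed_subspaceP; rewrite closed_spanE; split; first exact: closed_closure.
exact/closure_subspace/span_seq_subspace.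
Qed.

Lemma closed_span_subspace y : subspace (closed_span y).
Proof. by have /closed_subspaceP[] := closed_span_closed_subspace y. Qed.

Lemma closed_span_sub y u : span_seq y u -> closed_span y u.
Proof. by rewrite closed_spanE => ?; exact: subset_closure. Qed.

Lemma closed_span_min y V : closed_subspace V -> (forall k, V (y k)) ->
  closed_span y `<=` V.
Proof.
move=> /closed_subspaceP[cV sV] Vy; rewrite closed_spanE.
by rewrite [X in _ `<=` X](closure_id V).1 //; apply: closureS; exact: span_seq_min.
Qed.

Lemma bounded_operatorP V (T : X -> X) : bounded_operator V T <->
  linear_on V T /\ exists2 M : R, 0 <= M & forall u, V u -> N (T u) <= M * N u.
Proof.
split=> [[lT [M bT]]|[lT [M M0 bT]]]; split.
- by move=> a u v Vu Vv; apply: lT; rewrite in_setE.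
- exists (rho M); first exact: rho_ge0.
  move=> u Vu; have := bT u; rewrite in_setE => /(_ Vu) h.
  rewrite -(emb_le Q) rmorphM /= emb_rho !emb_nrm.
  have Mr : M * `|u| \is Num.real.
    by rewrite realE (le_trans (normr_ge0 _) h).
  apply: (le_trans h); by rewrite -[X in _ <= _ * X]normr_id -normrM; exact: real_ler_norm.
- by move=> a u v; rewrite !in_setE; exact: lT.
- exists (emb Q M) => u; rewrite in_setE => Vu.
  by rewrite -!(emb_nrm Q) -rmorphM emb_le bT.
Qed.

(** The closure of the correspondence between equal combinations of [y] and
    [z]; its single-valued branch extends that correspondence by continuity. *)
Definition comb_graph y z u v := forall d : R, 0 < d ->
  exists t n, N (u - comb y t n) < d /\ N (v - comb z t n) < d.

Lemma comb_graphC y z u v : comb_graph y z u v -> comb_graph z y v u.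
Proof. by move=> h d /h[t [n [h1 h2]]]; exists t, n. Qed.

Lemma comb_graph_span y z u v : comb_graph y z u v -> closed_span y u.
Proof.
move=> h; rewrite closed_spanE; apply/(closureP Q) => d /h[t [n [h1 _]]].
by exists (comb y t n) => //; exists t, n.
Qed.

Lemma comb_graph_lin y z a u v u' v' : comb_graph y z u v -> comb_graph y z u' v' ->
  comb_graph y z (a *: u + u') (a *: v + v').
Proof.
move=> h h' d d0; have ra := rho_ge0 Q a.
have d1 : 0 < d / (2 * (rho a + 1)) by rewrite divr_gt0 // mulr_gt0 //; lra.
have d2 : 0 < d / 2 by lra.
have [t [n [hu hv]]] := h _ d1; have [s [m [hu' hv']]] := h' _ d2.
have aux (w w' f f' : X) : N (w - f) < d / (2 * (rho a + 1)) -> N (w' - f') < d / 2 ->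
    N (a *: w + w' - (a *: f + f')) < d.
  rewrite ltr_pdivlMr; last lra; move=> h1 h2.
  rewrite opprD addrACA -scalerBr; apply: le_lt_trans (nrmD _ _ _) _; rewrite nrmZ.
  have : rho a * N (w - f) <= (rho a + 1) * N (w - f).
    by rewrite ler_wpM2r ?nrm_ge0 //; lra.
  lra.
exists (fun k => a * (if (k < n)%N then t k else 0) + (if (k < m)%N then s k else 0)).
exists (maxn n m); rewrite (comb_widen y t (leq_maxl n m)) (comb_widen y s (leq_maxr n m)) in hu hu'.
rewrite (comb_widen z t (leq_maxl n m)) (comb_widen z s (leq_maxr n m)) in hv hv'.
split; rewrite comb_lin; first exact: aux hu hu'.
exact: aux hv hv'.
Qed.

Section Extension.
Context (y z : nat -> X) (b : R) (b0 : 0 <= b).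
Context (yz : forall t n, N (comb z t n) <= b * N (comb y t n)).

Lemma comb_graph_le u v : comb_graph y z u v -> N v <= b * N u.
Proof.
move=> h; apply/ler_addgt0Pr => d d0; have b0' := b0.
have d1 : 0 < d / (b + 1) by rewrite divr_gt0 //; lra.
have [t [n []]] := h _ d1; set f := comb y t n; set g := comb z t n.
have := nrmB Q f u; have := nrmD Q (v - g) g; rewrite subrK.
have := nrmD Q (f - u) u; rewrite subrK (nrmBC Q f) => h1 h2 h3.
have : d / (b + 1) * (b + 1) = d by rewrite divfK // lt0r_neq0 //; lra.
move: (d / (b + 1)) => d' dE h4 h5.
have := yz t n; rewrite -/f -/g => h6.
have : b * N f <= b * (d' + N u) by rewrite ler_wpM2l //; lra.
lra.
Qed.

Lemma comb_graph_fun u v v' : comb_graph y z u v -> comb_graph y z u v' -> v = v'.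
Proof.
move=> h h'; have /comb_graph_le := comb_graph_lin (-1) h' h.
rewrite !scaleN1r addNr nrm0 mulr0 => h0; apply/eqP; rewrite -subr_eq0; apply/eqP.
by apply: (@nrm_eq0 _ _ Q); apply/eqP; rewrite eq_le nrm_ge0 andbT addrC.
Qed.

Lemma comb_graph_total u : closed_span y u -> exists v, comb_graph y z u v.
Proof.
rewrite closed_spanE => /(closureP Q) uy.
have /choice[f hf] : forall k, exists tn : (nat -> K) * nat,
    N (u - comb y tn.1 tn.2) < 2^-1 ^+ k.
  by move=> k; have [_ [t [n ->]] h] := uy _ (half_pow_gt0 R k); exists (t, n).
have b0' := b0.
pose g k := comb z (f k).1 (f k).2.
have [v gv] : exists v, ncvg g v.
  have [|v gv _] := @geometric_cvg _ _ Q X g (2 * b); last by exists v.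
  move=> k; rewrite /g.
  set m := maxn (f k).2 (f k.+1).2.
  rewrite (comb_widen z _ (leq_maxl (f k).2 (f k.+1).2)).
  rewrite (comb_widen z _ (leq_maxr (f k).2 (f k.+1).2)) addrC -scaleN1r -comb_lin.
  apply: le_trans (yz _ _) _; rewrite comb_lin.
  rewrite -(comb_widen y _ (leq_maxl (f k).2 (f k.+1).2)).
  rewrite -(comb_widen y _ (leq_maxr (f k).2 (f k.+1).2)) scaleN1r addrC.
  have := hf k; have := hf k.+1; rewrite exprS => h1 h2.
  have := nrm_tri Q u (comb y (f k.+1).1 (f k.+1).2) (comb y (f k).1 (f k).2).
  rewrite (nrmBC Q _ u) => h3.
  rewrite [2 * b]mulrC -mulrA ler_wpM2l //.
  have := half_pow_gt0 R k; lra.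
exists v => d d0; have [n0 hn] := gv _ d0; have [k hk] := half_pow_small 1 d0.
have h : 2^-1 ^+ maxn n0 k <= 2^-1 ^+ k :> R.
  by rewrite ler_wiXn2l ?leq_maxr //; lra.
exists (f (maxn n0 k)).1, (f (maxn n0 k)).2; split.
  by apply: lt_le_trans (hf _) _; lra.
by rewrite nrmBC; apply: hn; rewrite leq_maxl.
Qed.

Definition comb_ext u := xget 0 [set v | comb_graph y z u v].

Lemma comb_extP u : closed_span y u -> comb_graph y z u (comb_ext u).
Proof.
move=> /comb_graph_total[v hv]; rewrite /comb_ext; case: xgetP => // h.
by have := h v.
Qed.

Lemma comb_ext_bounded : bounded_operator (closed_span y) comb_ext.
Proof.
apply/bounded_operatorP; split; last first.
  by exists b => // u /comb_extP/comb_graph_le.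
move=> a u v yu yv; apply: (@comb_graph_fun (a *: u + v)).
  by apply: comb_extP; apply: (closed_span_subspace _).2.
by apply: comb_graph_lin; exact: comb_extP.
Qed.

End Extension.

Lemma comb_isomorphic y z (a b : R) : 0 <= a -> 0 <= b ->
  (forall t n, N (comb y t n) <= a * N (comb z t n)) ->
  (forall t n, N (comb z t n) <= b * N (comb y t n)) ->
  isomorphic (closed_span y) (closed_span z).
Proof.
move=> a0 b0 zy yz; exists (comb_ext y z).
have Yext := comb_extP b0 yz; have Zext := comb_extP a0 zy.
split; first exact: comb_ext_bounded b0 yz.
  apply/seteqP; split=> [_ [u yu <-]|v zv].
    by apply: comb_graph_span; apply: comb_graphC; exact: Yext.
  have h := comb_graphC (Zext _ zv).
  exists (comb_ext z y v); first exact: comb_graph_span h.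
  by apply: (comb_graph_fun b0 yz _ h); apply: Yext; exact: comb_graph_span h.
exists (comb_ext z y); first exact: comb_ext_bounded a0 zy.
move=> u; rewrite in_setE => yu; have h := comb_graphC (Yext _ yu).
by apply: (comb_graph_fun a0 zy _ h); apply: Zext; exact: comb_graph_span h.
Qed.

Context (e : nat -> X) (he : tight_by_support e).
Local Notation c := (basis_coord e).

(** The correspondence between equal combinations extends by continuity to an
    isomorphism of the closed spans; as coordinates are continuous, the supports
    of these spans are contained in the unions of the supports of the terms. *)
Lemma tight_no_equivalent y z (a b : R) : 0 <= a -> 0 <= b -> free_seq y ->
  (forall k l i, c (y k) i != 0 -> c (z l) i = 0) ->
  (forall t n, N (comb y t n) <= a * N (comb z t n)) ->
  (forall t n, N (comb z t n) <= b * N (comb y t n)) -> False.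
Proof.
move=> a0 b0 fy dis zy yz; have [hb tight] := he.
have [C C1 hC] := ps_bounded Q hb.
apply: tight (comb_isomorphic a0 b0 zy yz); try exact: closed_span_closed_subspace.
- by apply: free_seq_infinite_dim fy _ => k; apply/closed_span_sub/span_seq_mem.
- have fz : free_seq z.
    move=> t n zt; apply: (fy t n); apply: (@nrm_eq0 _ _ Q); apply/eqP.
    by rewrite eq_le nrm_ge0 andbT; have := zy t n; rewrite zt nrm0 mulr0.
  by apply: free_seq_infinite_dim fz _ => k; apply/closed_span_sub/span_seq_mem.
have inspan w i u : closed_span w u -> c u i != 0 -> exists k, c (w k) i != 0.
  rewrite closed_spanE => /(closureP Q) hu ui; apply: contrapT => h.
  move/eqP: ui; apply; apply: (coord_closed hb C1 hC) => d /hu[_ [t [n ->]] hd].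
  exists (comb w t n) => //; rewrite (coord_sum Q hb) big1 // => k _.
  rewrite (coordZ Q hb); have [->|wi] := eqVneq (c (w k) i) 0; first by rewrite mulr0.
  by exfalso; apply: h; exists k.
rewrite -subset0 => i [[u yu ui] [v zv vi]].
have [k yk] := inspan _ _ _ yu ui; have [l zl] := inspan _ _ _ zv vi.
by move/eqP: zl; apply; exact: dis yk.
Qed.

End ClosedSpans.
(** * Unconditionality *)

Lemma dependent_blocks (T : Type) (P : nat -> nat -> nat -> T -> Prop) :
  (forall k m, exists n g, (m <= n)%N /\ P k m n g) ->
  exists (p : nat -> nat) (g : nat -> T),
    forall k, (p k <= p k.+1)%N /\ P k (p k) (p k.+1) (g k).
Proof.
move=> h; have /choice[f hf] : forall km : nat * nat, exists ng : nat * T,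
    (km.2 <= ng.1)%N /\ P km.1 km.2 ng.1 ng.2.
  by move=> [k m]; have [n [g hg]] := h k m; exists (n, g).
pose p := fix p k := if k is k'.+1 then (f (k', p k')).1 else 0%N.
by exists p, (fun k => (f (k, p k)).2) => k; exact: hf (k, p k).
Qed.

Section Unconditional.
Context {R : realType} {K : numFieldType} (Q : real_scalars R K).
Context {X : completeNormedModType K} (e : nat -> X) (he : tight_by_support e).
Implicit Types (x u v : X) (A : pred nat).
Local Notation N := (nrm Q).
Local Notation rho := (rho Q).
Local Notation c := (basis_coord e).
Local Notation ps := (partial_sum e).
Local Notation pr := (trunc_proj e).
Local Notation supported := (supported e).
Let hb : schauder_basis e := he.1.

Lemma multiplier_crude : exists2 B : R, 0 <= B & forall (m : nat -> K) n x,
  (forall i, rho (m i) <= 1) ->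
  N (\sum_(i < n) (m i * c x i) *: e i) <= n%:R * B * N x.
Proof.
have [C C1 hC] := ps_bounded Q hb; exists (2 * C) => [|m n x m1]; first by lra.
apply: le_trans (nrm_sum _ _ _ _) _.
have -> : n%:R * (2 * C) * N x = \sum_(i < n) (2 * C * N x).
  by rewrite sumr_const card_ord -[RHS]mulr_natl !mulrA.
apply: ler_sum => i _; rewrite nrmZ rhoM.
apply: le_trans (coord_le hC x i); rewrite ler_wpM2r ?nrm_ge0 //.
by rewrite ler_piMl // rho_ge0.
Qed.

(** If the coordinate projections were unbounded on all tails, there would be
    successive blocks [u] with a part [y] much larger than [u] itself; then [y] and the opposite of the rest of [u] are nearly equal, hence
    equivalent, with disjoint supports. *)
Lemma unconditional_tail : exists n0 (C1 : R), forall A n x,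
  supported n0 n x -> N (pr A n x) <= C1 * N x.
Proof.
have [C C1 hC] := ps_bounded Q hb.
have C0 : 0 < C by apply: lt_le_trans C1.
apply: contrapT => hn.
pose d k : R := (4 * C)^-1 * 2^-1 ^+ k.+1.
have d0 k : 0 < d k by rewrite mulr_gt0 ?half_pow_gt0 // invr_gt0 mulr_gt0.
have [|p [g hg]] := @dependent_blocks (X * X) (fun k m n yz =>
    [/\ supported m n yz.1, supported m n yz.2, yz.1 != 0,
        forall i, c yz.1 i != 0 -> c yz.2 i = 0
      & N (yz.1 - yz.2) <= d k * N yz.1]).
  move=> k m; have [A [n [x [sx hx]]]] : exists A n x,
      supported m n x /\ (d k)^-1 * N x < N (pr A n x).
    apply: contrapT => h; apply: hn; exists m, (d k)^-1 => A n x sx.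
    by rewrite leNgt; apply/negP => ?; apply: h; exists A, n, x.
  exists (maxn m n), (pr A n x, pr A n x - x); split; first exact: leq_maxl.
  have sy : supported m (maxn m n) (pr A n x).
    move=> i hi; rewrite (coord_pr Q hb); case: ifP => // _; apply: sx.
    by apply: contra hi => /andP[-> h]; rewrite leq_max h orbT.
  have sx' := supportedW (leqnn m) (leq_maxr m n) sx.
  split=> //=.
  - exact: (subspaceB (supported_subspace Q hb _ _)).
  - apply/eqP => y0; move: hx; rewrite y0 nrm0 ltNge; apply/negP; rewrite negbK.
    by rewrite mulr_ge0 ?nrm_ge0 // invr_ge0 ltW.
  - move=> i; rewrite (coordB Q hb) (coord_pr Q hb); case: ifP; rewrite ?eqxx ?subrr //.
  - rewrite subKr; move: hx; rewrite mulrC ltr_pdivrMr // mulrC => hx; exact: ltW.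
pose y k := (g k).1; pose z k := (g k).2; pose r k := y k - z k.
have bY : blocks e p y by move=> k; have [? []] := hg k.
have rE t n : comb z t n = comb y t n - comb r t n.
  rewrite /comb -sumrB; apply: eq_bigr => k _.
  by rewrite -scalerBr /r subKr.
have rle t n : N (comb r t n) <= N (comb y t n) / 2.
  have := block_perturbation (r := r) hb hC t n bY (fun k => ltW (d0 k)).
  move=> /(_ (fun k => let: conj _ (And5 _ _ _ _ h) := hg k in h)) h.
  apply: le_trans h _; rewrite mulrC ler_wpM2l ?nrm_ge0 //.
  rewrite /d -mulr_sumr half_pow_sum.
  have -> : 2 * C * ((4 * C)^-1 * (1 - 2^-1 ^+ n)) = (1 - 2^-1 ^+ n) / 2.
    by field; rewrite lt0r_neq0.
  by have := half_pow_gt0 R n; lra.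
apply: (@tight_no_equivalent _ _ Q _ e he y z 2 2) => //.
- by apply: (block_free hb hC bY) => k; have [_ []] := hg k.
- move=> k l i yi; have [->|lk] := eqVneq l k.
    by have [_ [_ _ _ + _]] := hg k; apply.
  have ki : (p k <= i < p k.+1)%N.
    by apply: contraT => /(bY k).2 h; rewrite h eqxx in yi.
  have bz : blocks e p z by move=> j; have [? []] := hg j.
  exact: (blocks_coord0 bz ki).
- move=> t n; have := rle t n; rewrite rE.
  by have := nrmD Q (comb y t n - comb r t n) (comb r t n); rewrite subrK; lra.
- move=> t n; have := rle t n; rewrite rE.
  have := nrm_ge0 Q (comb y t n); have := nrmB Q (comb y t n) (comb r t n); lra.
Qed.

(** The coordinates below [n0] contribute a bounded operator of finite rank. *)
Lemma unconditional : exists2 C : R, 0 <= C & forall A n x, N (pr A n x) <= C * N x.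
Proof.
have [C C1 hC] := ps_bounded Q hb; have [B B0 hB] := multiplier_crude.
have [n0 [D hD]] := unconditional_tail.
have crude A n x : (n <= n0)%N -> N (pr A n x) <= n0%:R * B * N x.
  move=> nn; have -> : pr A n x = \sum_(i < n) (((A i)%:R : K) * c x i) *: e i.
    by apply: eq_bigr => i _; case: (A i); rewrite ?mul1r ?mul0r.
  apply: le_trans (hB (fun i => (A i)%:R) _ _ _) _.
    by move=> i; case: (A i); rewrite ?rho1 ?rho0.
  by rewrite ler_wpM2r ?nrm_ge0 // ler_wpM2r // ler_nat.
pose D' := Num.max 0 D.
have D'0 : 0 <= D' by rewrite le_max lexx.
have n0B : 0 <= n0%:R * B by rewrite mulr_ge0.
exists (n0%:R * B + D' * (2 * C)) => [|A n x].
  by rewrite addr_ge0 // mulr_ge0 //; lra.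
have x0 := nrm_ge0 Q x.
have DC : 0 <= D' * (2 * C * N x) by rewrite mulr_ge0 // mulr_ge0 //; lra.
rewrite mulrDl; have [nn|nn] := leqP n n0.
  by have := crude A n x nn; lra.
have -> : pr A n x = pr A n0 x + pr A n (ps n x - ps n0 x).
  apply: (coord_inj Q hb) => i; rewrite (coordD Q hb) !(coord_pr Q hb) (coordB Q hb).
  rewrite !(coord_ps Q hb); case: (A i); rewrite ?andbF ?andbT ?addr0 //.
  case: (ltnP i n0) => [h|h]; first by rewrite (ltn_trans h nn) subrr addr0.
  by case: ltnP; rewrite ?subr0 add0r.
apply: le_trans (nrmD _ _ _) _; apply: lerD; first exact: crude.
apply: (le_trans (hD _ _ _ (supported_ps_diff Q hb x (ltnW nn)))).
have := ps_diff_le hC n0 n x => h; rewrite -mulrA.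
apply: le_trans (ler_wpM2l D'0 h); rewrite ler_wpM2r ?nrm_ge0 //.
by rewrite le_max lexx orbT.
Qed.

(** The best constant [M] for multipliers of modulus at most one satisfies
    [M <= F + M / 2] for a constant [F], because such a multiplier is within one
    half of one with values in a finite set, that is, of a combination of
    projections, whose norm [F] controls. *)
Lemma multiplier_bounded : exists2 C : R, 0 <= C & forall (a : R) n u v,
  0 <= a -> supported 0 n v -> (forall i, rho (c u i) <= a * rho (c v i)) ->
  N u <= C * a * N v.
Proof.
have [C C0 hC] := unconditional; have [B B0 hB] := multiplier_crude.
have half0 : 0 < 2^-1 :> R by rewrite invr_gt0.
have [s hs] := bounded_net Q 1 half0.
pose F := \sum_(a <- undup s) rho a * C.
have F0 : 0 <= F by apply: sumr_ge0 => a _; rewrite mulr_ge0 // rho_ge0.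
pose M (m : nat -> K) n v := \sum_(i < n) (m i * c v i) *: e i.
have cM m n v i : c (M m n v) i = if (i < n)%N then m i * c v i else 0.
  exact: (coord_sum_e Q hb n (fun i => m i * c v i)).
(* The inequality [M <= F + M / 2], iterated [k] times from a crude bound. *)
have step k n v m : (forall i, rho (m i) <= 1) ->
    N (M m n v) <= (2 * F + n%:R * B * 2^-1 ^+ k) * N v.
  elim: k m => [|k IH] m m1.
    rewrite expr0 mulr1 mulrDl; have := hB m n v m1.
    have : 0 <= 2 * F * N v by rewrite mulr_ge0 ?nrm_ge0 //; lra.
    by rewrite /M; lra.
  have /choice[b hbs] : forall i, exists b, b \in s /\ rho (m i - b) <= 2^-1.
    by move=> i; have [b bs hb'] := hs _ (m1 i); exists b.
  (* [m = b + m' / 2] with [b] valued in the net and [m'] again of modulus at most 1. *)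
pose m' i := emb Q 2 * (m i - b i).
  have m'1 i : rho (m' i) <= 1.
    rewrite rhoM rho_emb ger0_norm //; have := (hbs i).2; lra.
  have -> : M m n v = \sum_(a <- undup s) a *: pr (fun i => b i == a) n v
      + emb Q 2^-1 *: M m' n v.
    apply: (coord_inj Q hb) => i.
    rewrite !cM (coordD Q hb) (coordZ Q hb) cM (coord_sum Q hb).
    under eq_bigr do rewrite (coordZ Q hb) (coord_pr Q hb).
    case: ltnP => _ /=; last by rewrite mulr0 addr0 big1 // => a _; rewrite mulr0.
    rewrite (bigD1_seq (b i)) /= ?undup_uniq ?mem_undup ?(hbs i).1 //=.
    rewrite eqxx big1 => [|a]; last by rewrite eq_sym => /negPf ->; rewrite mulr0.
    rewrite addr0 /m' !mulrA -rmorphM /= mulVf // rmorph1 mul1r -mulrDl addrC subrK //.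
  apply: le_trans (nrmD _ _ _) _; rewrite nrmZ rho_emb ger0_norm ?invr_ge0 //.
  have h1 : N (\sum_(a <- undup s) a *: pr (fun i => b i == a) n v) <= F * N v.
    apply: le_trans (nrm_sum _ _ _ _) _; rewrite mulr_suml; apply: ler_sum => a _.
    by rewrite nrmZ -mulrA ler_wpM2l ?rho_ge0.
  have := IH m' m'1; rewrite exprS; lra.
have lim n v m : (forall i, rho (m i) <= 1) -> N (M m n v) <= 2 * F * N v.
  move=> m1; apply/ler_addgt0Pr => d d0.
  have [k hk] := half_pow_small (n%:R * B * N v) d0.
  by have := step k n v m m1; lra.
exists (2 * F) => [|a n u v a0 sv uv]; first by lra.
have v0 i : c v i = 0 -> c u i = 0.
  move=> vi; apply: (@rho_eq0 _ _ Q); apply/eqP; rewrite eq_le rho_ge0 andbT.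
  by have := uv i; rewrite vi rho0 mulr0.
have [a0'|an0] := eqVneq a 0.
  have -> : u = 0.
    apply: (coord_inj Q hb) => i; rewrite (coord0 Q hb).
    apply: (@rho_eq0 _ _ Q); apply/eqP; rewrite eq_le rho_ge0 andbT.
    by have := uv i; rewrite a0' mul0r.
  by rewrite nrm0 !mulr_ge0 ?nrm_ge0 //; lra.
have ap : 0 < a by rewrite lt0r an0.
pose m i := (emb Q a)^-1 * (c u i / c v i).
have m1 i : rho (m i) <= 1.
  rewrite rhoM !rhoM !rhoV rho_emb gtr0_norm // mulrC ler_pdivrMr // mul1r.
  have [vi|vi] := eqVneq (c v i) 0; first by rewrite vi rho0 invr0 mulr0.
  by rewrite ler_pdivrMr // rho_gt0.
have -> : u = emb Q a *: M m n v.
  apply: (coord_inj Q hb) => i; rewrite (coordZ Q hb) cM.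
  case: ifP => [_|ni]; last by rewrite mulr0 v0 // sv // ni.
  rewrite /m !mulrA divff ?fmorph_eq0 // mul1r.
  have [vi|vi] := eqVneq (c v i) 0; first by rewrite vi mulr0 v0.
  by rewrite divfK.
rewrite nrmZ rho_emb gtr0_norm // mulrAC mulrC ler_wpM2r //; exact: lim.
Qed.

End Unconditional.
(** * Concentration of vectors and of their images on sets of coordinates *)

Section Graphs.
Context {R : realType} {K : numFieldType} (Q : real_scalars R K).
Context {X : completeNormedModType K} (e : nat -> X) (he : tight_by_support e).
Implicit Types (x u v : X) (A : pred nat) (g : X * X) (G : set (X * X)).
Local Notation N := (nrm Q).
Local Notation rho := (rho Q).
Local Notation c := (basis_coord e).
Local Notation ps := (partial_sum e).
Local Notation pr := (trunc_proj e).
Local Notation supported := (supported e).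
Let hb : schauder_basis e := he.1.

Definition finsupp x := exists n, supported 0 n x.

Lemma finsupp_subspace : subspace finsupp.
Proof.
split; first by exists 0%N; exact: (supported_subspace Q hb _ _).1.
move=> a u v [n hn] [m hm]; exists (maxn n m).
apply: (supported_subspace Q hb _ _).2.
  exact: supportedW (leqnn 0%N) (leq_maxl n m) hn.
exact: supportedW (leqnn 0%N) (leq_maxr n m) hm.
Qed.

(** For finitely supported [x] any truncation beyond the support gives the same
    projection; for other [x] the default truncation at 0 is used. *)
Definition coord_proj A x : X := pr A (xget 0%N [set n | supported 0 n x]) x.
Local Notation Pr := coord_proj.

Lemma coord_coord_proj A x i : finsupp x -> c (Pr A x) i = if A i then c x i else 0.
Proof.
move=> fx; rewrite /coord_proj (coord_pr Q hb); have := xgetPex 0%N fx.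
move: (xget _ _) => n hn; case: (ltnP i n) => // ni.
by case: (A i) => //=; apply/esym/hn; rewrite /= -leqNgt.
Qed.

Lemma coord_proj_lin A a u v : finsupp u -> finsupp v ->
  Pr A (a *: u + v) = a *: Pr A u + Pr A v.
Proof.
move=> fu fv; apply: (coord_inj Q hb) => i; have fuv := finsupp_subspace.2 a u v fu fv.
rewrite (coord_lin Q hb) !coord_coord_proj // (coord_lin Q hb).
by case: ifP; rewrite // mulr0 addr0.
Qed.

Lemma coord_proj_compl A x : finsupp x -> x = Pr A x + Pr (predC A) x.
Proof.
move=> fx; apply: (coord_inj Q hb) => i; rewrite (coordD Q hb) !coord_coord_proj //=.
by case: (A i); rewrite ?addr0 ?add0r.
Qed.

Lemma blocks_ge p (y : nat -> X) k : blocks e p y -> (forall k, y k != 0) -> (k <= p k)%N.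
Proof.
move=> hp y0; elim: k => // k IH; apply: (leq_ltn_trans IH).
rewrite ltnNge; apply/negP => h; move/eqP: (y0 k); apply.
apply: (coord_inj Q hb) => i; rewrite (coord0 Q hb) (hp k).2 //.
by apply/negP => /andP[h1 h2]; have := leq_trans h2 (leq_trans h h1); rewrite ltnn.
Qed.

Lemma comb_fst (g : nat -> X * X) t n : (comb g t n).1 = comb (fst \o g) t n.
Proof. by rewrite /comb (big_morph fst (id1 := 0) (op1 := +%R)). Qed.

Lemma comb_snd (g : nat -> X * X) t n : (comb g t n).2 = comb (snd \o g) t n.
Proof. by rewrite /comb (big_morph snd (id1 := 0) (op1 := +%R)). Qed.

(** An operator is studied through a subspace of its graph.  The subspace is
    shrunk repeatedly; what must survive is that it contains pairs with non-zero
    first component supported arbitrarily far out, since these provide block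
    sequences. *)
Definition far_reaching G := subspace G /\
  forall m, exists g n, [/\ G g, g.1 != 0 & supported m n g.1].

Lemma far_reaching_nonzero G : far_reaching G -> exists2 g, G g & g.1 != 0.
Proof. by move=> [_ /(_ 0%N)[g [n [Gg g0 _]]]]; exists g. Qed.

Lemma far_reaching_span p (g : nat -> X * X) : blocks e p (fst \o g) -> (forall k, (g k).1 != 0) ->
  far_reaching (span_seq g).
Proof.
move=> hp g0; split; first exact: span_seq_subspace.
move=> m; exists (g m), (p m.+1); split=> //; first exact: span_seq_mem.
by apply: supportedW (hp m).2 => //; exact: blocks_ge hp g0.
Qed.

Context (C : R) (C1 : 1 <= C) (hC : forall n x, N (ps n x) <= C * N x).

(** Pairs on which [F] is geometrically small form a block sequence; by
    [block_perturbation] the smallness extends to its whole span. *)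
Lemma shrink_small G (F : X * X -> X) (d : R) : far_reaching G -> linear_on G F -> 0 < d ->
  (forall m (h : R), 0 < h -> exists g n,
     [/\ G g, g.1 != 0, supported m n g.1 & N (F g) <= h * N g.1]) ->
  exists G', [/\ far_reaching G', G' `<=` G & forall g, G' g -> N (F g) <= d * N g.1].
Proof.
move=> [sG _] lF d0 hF; have C0 : 0 < C by apply: lt_le_trans C1.
pose dk k : R := d / (2 * C) * 2^-1 ^+ k.+1.
have dk0 k : 0 < dk k by rewrite mulr_gt0 ?half_pow_gt0 // divr_gt0 // mulr_gt0.
have [|p [g hg]] := @dependent_blocks (X * X) (fun k m n g =>
    [/\ G g, g.1 != 0, supported m n g.1 & N (F g) <= dk k * N g.1]).
  move=> k m; have [g [n [Gg g0 sg Fg]]] := hF m _ (dk0 k).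
  exists (maxn m n), g; split; first exact: leq_maxl.
  by split=> //; apply: supportedW sg => //; exact: leq_maxr.
have hp : blocks e p (fst \o g) by move=> k; have [? []] := hg k.
have g0 k : (g k).1 != 0 by have [_ []] := hg k.
have Gg k : G (g k) by have [_ []] := hg k.
exists (span_seq g); split; first exact: far_reaching_span hp g0.
  exact: span_seq_min.
move=> _ [t [n ->]]; rewrite comb_fst.
have -> : F (comb g t n) = comb (F \o g) t n.
  rewrite /comb (linear_on_sum _ sG lF) => [|k _]; last exact: subspaceZ.
  by apply: eq_bigr => k _; rewrite (linear_onZ _ sG lF).
have /(_ t n hp (fun k => ltW (dk0 k))) := @block_perturbation _ _ Q _ e hb C hC p (fst \o g) (F \o g) dk.
move=> /(_ (fun k => let: conj _ (And4 _ _ _ h) := hg k in h)) h.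
apply: le_trans h _; rewrite ler_wpM2r ?nrm_ge0 // /dk -mulr_sumr half_pow_sum mulrA.
have -> : 2 * C * (d / (2 * C)) = d by field; rewrite lt0r_neq0.
by have := half_pow_gt0 R n; rewrite ler_piMr //; lra.
Qed.

(** If neither [F] nor [H] becomes small on a smaller subspace, both are bounded
    below far enough out, and so they map one block sequence to two equivalent
    sequences with disjoint supports, against tightness. *)
Lemma dichotomy G (F H : X * X -> X) (B d : R) : far_reaching G -> linear_on G F -> linear_on G H ->
  0 <= B -> 0 < d ->
  (forall g, G g -> N (F g) <= B * N g.1) -> (forall g, G g -> N (H g) <= B * N g.1) ->
  (forall g g' i, G g -> G g' -> c (F g) i != 0 -> c (H g') i = 0) ->
  exists G', [/\ far_reaching G', G' `<=` G & (forall g, G' g -> N (F g) <= d * N g.1) \/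
                                     (forall g, G' g -> N (H g) <= d * N g.1)].
Proof.
move=> bG lF lH B0 d0 FB HB dis; have [sG farG] := bG.
have key (E : X * X -> X) : linear_on G E ->
    (exists G', [/\ far_reaching G', G' `<=` G & forall g, G' g -> N (E g) <= d * N g.1]) \/
    exists m (h : R), 0 < h /\ forall g n, G g -> supported m n g.1 -> h * N g.1 <= N (E g).
  move=> lE; have [hs|hns] := pselect (forall m (h : R), 0 < h -> exists g n,
     [/\ G g, g.1 != 0, supported m n g.1 & N (E g) <= h * N g.1]).
    by left; exact: shrink_small bG lE d0 hs.
  right; apply: contrapT => hn; apply: hns => m h h0.
  apply: contrapT => hn'; apply: hn; exists m, h; split=> // g n Gg sg.
  have [->|g0] := eqVneq g.1 0; first by rewrite nrm0 mulr0 nrm_ge0.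
  by rewrite leNgt; apply/negP => /ltW ?; apply: hn'; exists g, n.
have [[G' [? ? ?]]|[m1 [h1 [h10 F1]]]] := key F lF; first by exists G'; split=> //; left.
have [[G' [? ? ?]]|[m2 [h2 [h20 H2]]]] := key H lH; first by exists G'; split=> //; right.
exfalso; pose m0 := maxn m1 m2.
have [|p [g hg]] := @dependent_blocks (X * X) (fun k m n g =>
    [/\ G g, g.1 != 0, supported m n g.1 & supported m0 n g.1]).
  move=> k m; have [g [n [Gg g0 sg]]] := farG (maxn m m0).
  exists (maxn m n), g; split; first exact: leq_maxl.
  split=> //; apply: supportedW sg; rewrite ?leq_maxl ?leq_maxr //.
have hp : blocks e p (fst \o g) by move=> k; have [? []] := hg k.
have g0 k : (g k).1 != 0 by have [_ []] := hg k.
have Gg k : G (g k) by have [_ []] := hg k.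
have Gcomb t n : G (comb g t n) by apply: subspace_sum => // k _; exact: subspaceZ.
have scomb t n : supported m0 (p n) (comb g t n).1.
  rewrite comb_fst; apply: subspace_sum => [|k _]; first exact: (supported_subspace Q hb).
  apply: (subspaceZ _ (supported_subspace Q hb _ _)).
  have [_ [_ _ _ h]] := hg k; apply: supportedW h => //.
  exact: (blocks_mono hp).
have lcomb (E : X * X -> X) t n : linear_on G E -> E (comb g t n) = comb (E \o g) t n.
  move=> lE; rewrite /comb (linear_on_sum _ sG lE) => [|k _]; last exact: subspaceZ.
  by apply: eq_bigr => k _; rewrite (linear_onZ _ sG lE).
have Fge t n : h1 * N (comb g t n).1 <= N (comb (F \o g) t n).
  rewrite -lcomb //; apply: F1 (Gcomb t n) _; apply: supportedW (scomb t n) => //.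
  exact: leq_maxl.
have Hge t n : h2 * N (comb g t n).1 <= N (comb (H \o g) t n).
  rewrite -lcomb //; apply: H2 (Gcomb t n) _; apply: supportedW (scomb t n) => //.
  exact: leq_maxr.
apply: (@tight_no_equivalent _ _ Q _ e he (F \o g) (H \o g) (B / h2) (B / h1)).
- by rewrite divr_ge0 // ltW.
- by rewrite divr_ge0 // ltW.
- move=> t n F0; apply: (block_free hb hC hp g0 (t := t)); rewrite -comb_fst.
  have := Fge t n; rewrite F0 nrm0 pmulr_rle0 // => h.
  by apply: (@nrm_eq0 _ _ Q); apply/eqP; rewrite eq_le h nrm_ge0.
- by move=> k l i; apply: dis.
- move=> t n; rewrite -lcomb //; apply: le_trans (FB _ (Gcomb t n)) _.
  by rewrite -mulrA ler_wpM2l // mulrC ler_pdivlMr // mulrC.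
- move=> t n; rewrite -lcomb //; apply: le_trans (HB _ (Gcomb t n)) _.
  by rewrite -mulrA ler_wpM2l // mulrC ler_pdivlMr // mulrC.
Qed.

Context (U : R) (U0 : 0 <= U) (hU : forall A n x, N (pr A n x) <= U * N x).

Definition admissible (B : R) G :=
  forall g, G g -> [/\ finsupp g.1, finsupp g.2 & N g.2 <= B * N g.1].

(** The dichotomy is used twice: for the first component on [A] against the
    first component off [A], then for the first component on [A] against the
    second component off [A]. *)
Lemma concentrate (B d : R) G A : 1 <= B -> 0 < d -> far_reaching G -> admissible B G ->
  exists G', [/\ far_reaching G', G' `<=` G & (forall g, G' g -> N (Pr A g.1) <= d * N g.1) \/
    (forall g, G' g -> N (Pr (predC A) g.1) <= d * N g.1 /\
                       N (Pr (predC A) g.2) <= d * N g.1)].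
Proof.
move=> B1 d0 bG aG.
have UB : 0 <= U * B by rewrite mulr_ge0 //; lra.
have lin1 A' : linear_on G (fun g => Pr A' g.1).
  by move=> a g g' /aG[? _ _] /aG[? _ _]; exact: coord_proj_lin.
have lin2 A' : linear_on G (fun g => Pr A' g.2).
  by move=> a g g' /aG[_ ? _] /aG[_ ? _]; exact: coord_proj_lin.
have bd1 A' g : G g -> N (Pr A' g.1) <= U * B * N g.1.
  move=> _; apply: le_trans (hU _ _ _) _; rewrite ler_wpM2r ?nrm_ge0 //.
  by rewrite ler_peMr.
have bd2 A' g : G g -> N (Pr A' g.2) <= U * B * N g.1.
  by move=> /aG[_ _ h]; apply: le_trans (hU _ _ _) _; rewrite -mulrA ler_wpM2l.
have [|G1 [bG1 G1G [s|s1]]] := dichotomy bG (lin1 A) (lin1 (predC A)) UB d0 (bd1 _) (bd1 _).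
- move=> g g' i /aG[f _ _] /aG[f' _ _]; rewrite !coord_coord_proj //=.
  by case: (A i); rewrite // eqxx.
- by exists G1; split=> //; left.
have [|||||G2 [bG2 G2G1 [s|s2]]] := @dichotomy G1 (fun g => Pr A g.1) (fun g => Pr (predC A) g.2) _ _ bG1 _ _ UB d0.
- by move=> a g g' /G1G Gg /G1G Gg'; exact: lin1.
- by move=> a g g' /G1G Gg /G1G Gg'; exact: lin2.
- by move=> g /G1G; exact: bd1.
- by move=> g /G1G; exact: bd2.
- move=> g g' i /G1G/aG[f _ _] /G1G/aG[_ f' _]; rewrite !coord_coord_proj //=.
  by case: (A i); rewrite // eqxx.
- by exists G2; split=> //; [exact: subset_trans G2G1 G1G | left].
exists G2; split=> //; first exact: subset_trans G2G1 G1G.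
by right=> g Gg; split; [apply/s1/G2G1 | exact: s2].
Qed.

End Graphs.
(** * Approximate eigenvalues *)

Section ApproximateEigenvalues.
Context {R : realType} {K : numFieldType} (Q : real_scalars R K).
Context {X : completeNormedModType K} (e : nat -> X) (he : tight_by_support e).
Implicit Types (x u v : X) (A : pred nat) (g : X * X) (G : set (X * X)).
Local Notation N := (nrm Q).
Local Notation rho := (rho Q).
Local Notation c := (basis_coord e).
Local Notation ps := (partial_sum e).
Local Notation pr := (trunc_proj e).
Local Notation Pr := (coord_proj e).
Local Notation far_reaching := (far_reaching e).
Local Notation finsupp := (finsupp e).
Local Notation supported := (supported e).
Local Notation admissible := (admissible Q e).
Let hb : schauder_basis e := he.1.

(** A multiplier by [lam], except that second components are arbitrary at the
    coordinates outside [live]. *)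
Definition diagonal (lam : nat -> K) (live : pred nat) G := forall g, G g -> forall i,
  if live i then c g.2 i = lam i * c g.1 i else c g.1 i = 0.

Definition near_cell (lam : nat -> K) (live : pred nat) (h : R) (s : seq K) : pred nat :=
  fun i => live i && has (fun a => rho (lam i - a) <= h) s.

Section Diagonal.
Context (U : R) (U0 : 0 <= U) (hU : forall A n x, N (pr A n x) <= U * N x).
Context (M : R) (M0 : 0 <= M).
Context (hM : forall (a : R) n u v, 0 <= a -> supported 0 n v ->
  (forall i, rho (c u i) <= a * rho (c v i)) -> N u <= M * a * N v).
Context (B : R) (B1 : 1 <= B) (lam : nat -> K) (live : pred nat).

(** Each cell of the net either carries almost everything, and then the second
    component is almost a multiple of the first, or carries almost nothing. *)
Lemma eigen_or_negligible (h d L : R) (s : seq K) G : 0 <= h -> 0 < d -> 0 <= L ->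
  (forall a, a \in s -> rho a <= L) -> far_reaching G -> admissible B G -> diagonal lam live G ->
  (exists2 a, a \in s & exists G', [/\ far_reaching G', G' `<=` G &
     forall g, G' g -> N (g.2 - a *: g.1) <= (M * h + d * (1 + L)) * N g.1]) \/
  (exists G', [/\ far_reaching G', G' `<=` G & forall g, G' g ->
     N (Pr (near_cell lam live h s) g.1) <= (size s)%:R * d * N g.1]).
Proof.
move=> h0 d0 L0; elim: s => [|a s IH] sL bG aG dG.
  right; exists G; split=> // g /aG[f _ _]; suff -> : Pr (near_cell lam live h [::]) g.1 = 0.
    by rewrite nrm0 mul0r mul0r.
  by apply: (coord_inj Q hb) => i; rewrite (coord_coord_proj Q he) // (coord0 Q hb) /near_cell andbF.
have [|[b bs hb']|[G1 [bG1 G1G s1]]] := IH _ bG aG dG.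
- by move=> b bs; apply: sL; rewrite in_cons bs orbT.
- by left; exists b => //; rewrite in_cons bs orbT.
(* The cell of [a] without the cells already treated, to have disjoint pieces. *)
pose A : pred nat := fun i => [&& live i, rho (lam i - a) <= h & ~~ near_cell lam live h s i].
have aG1 : admissible B G1 by move=> g /G1G; exact: aG.
have [C C1 hC] := ps_bounded Q hb.
have [G2 [bG2 G2G1 [sm|sm]]] := concentrate he C1 hC U0 hU A B1 d0 bG1 aG1.
  right; exists G2; split=> //; first exact: subset_trans G2G1 G1G.
  move=> g G2g; have [f _ _] := aG1 _ (G2G1 _ G2g).
  have -> : Pr (near_cell lam live h (a :: s)) g.1 = Pr (near_cell lam live h s) g.1 + Pr A g.1.
    apply: (coord_inj Q hb) => i; rewrite (coordD Q hb) !(coord_coord_proj Q he) // /A /near_cell /=.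
    case: (live i) => /=; last by rewrite addr0.
    by case: (rho _ <= h); case: (has _ s); rewrite /= ?addr0 ?add0r.
  have := nrmD Q (Pr (near_cell lam live h s) g.1) (Pr A g.1).
  have := sm _ G2g; have := s1 _ (G2G1 _ G2g).
  by rewrite -natr1; lra.
left; exists a; first exact: mem_head.
exists G2; split=> //; first exact: subset_trans G2G1 G1G.
move=> g G2g; have [f1 f2 _] := aG1 _ (G2G1 _ G2g).
have aL : rho a <= L by apply: sL; exact: mem_head.
have f : finsupp (g.2 - a *: g.1).
  apply: (subspaceB (finsupp_subspace Q he)) => //.
  exact: (subspaceZ _ (finsupp_subspace Q he)).
have -> : g.2 - a *: g.1 = Pr A (g.2 - a *: g.1) + (Pr (predC A) g.2 - a *: Pr (predC A) g.1).
  rewrite {1}(coord_proj_compl Q he A f); congr (_ + _).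
  by rewrite addrC -scaleNr (coord_proj_lin Q he) // scaleNr addrC.
have [s2 s3] := sm _ G2g.
have [n hn] := f1.
have k1 : N (Pr A (g.2 - a *: g.1)) <= M * h * N g.1.
  apply: (hM h0 hn) => i; rewrite (coord_coord_proj Q he) //.
  case: ifP => [/and3P[li ha _]|_]; last by rewrite rho0 mulr_ge0 // rho_ge0.
  have := dG _ (G1G _ (G2G1 _ G2g)) i; rewrite li (coordB Q hb) (coordZ Q hb) => ->.
  by rewrite -mulrBl rhoM ler_wpM2r // rho_ge0.
have := nrmD Q (Pr A (g.2 - a *: g.1)) (Pr (predC A) g.2 - a *: Pr (predC A) g.1).
have := nrmB Q (Pr (predC A) g.2) (a *: Pr (predC A) g.1); rewrite nrmZ.
have : rho a * N (Pr (predC A) g.1) <= L * (d * N g.1) by apply: ler_pM; rewrite ?rho_ge0 ?nrm_ge0.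
lra.
Qed.

(** The net covers the scalars of modulus at most [L].  At the coordinates
    outside all its cells the multiplier exceeds [L], so the first component has
    there at most [M * B / L <= 1 / 4] of its norm.  If all cells were negligible
    as well, they would carry at most another quarter, which is absurd. *)
Lemma diagonal_eigenvalue (d : R) G : 0 < d -> far_reaching G -> admissible B G -> diagonal lam live G ->
  exists a G', [/\ far_reaching G', G' `<=` G & forall g, G' g -> N (g.2 - a *: g.1) <= d * N g.1].
Proof.
move=> d0 bG aG dG; have M0' := M0; have B1' := B1.
have MB : 0 <= M * B by rewrite mulr_ge0 //; lra.
pose L := 4 * (M * B) + 1.
have L0 : 0 < L by rewrite /L; lra.
pose h := d / (2 * (M + 1)).
have h0 : 0 < h by rewrite divr_gt0 // mulr_gt0 //; lra.
have [s hs] := bounded_net Q L h0.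
pose L' := \sum_(a <- s) rho a.
have L'0 : 0 <= L' by apply: sumr_ge0 => *; exact: rho_ge0.
have sL a : a \in s -> rho a <= L'.
  move=> as_; rewrite /L' (big_rem a as_) /= lerDl.
  by apply: sumr_ge0 => *; exact: rho_ge0.
pose q : R := (size s)%:R; have q0 : 0 <= q by exact: ler0n.
pose d' := Num.min (d / (2 * (1 + L'))) ((4 * (q + 1))^-1).
have d'0 : 0 < d'.
  by rewrite lt_min divr_gt0 ?invr_gt0 ?mulr_gt0 //; lra.
have : d' <= d' by []; rewrite {2}/d' le_min => /andP[].
rewrite ler_pdivlMr ?mulr_gt0 //; last lra.
rewrite -[(4 * _)^-1]mul1r ler_pdivlMr ?mulr_gt0 //; last lra.
move=> d1 d2; have hE : h * (2 * (M + 1)) = d by rewrite /h divfK // lt0r_neq0 // mulr_gt0 //; lra.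
have [[a as_ [G' [bG' G'G hG']]]|[G' [bG' G'G hG']]] :=
    eigen_or_negligible (ltW h0) d'0 L'0 sL bG aG dG.
  exists a, G'; split=> // g /hG' hg; apply: le_trans hg _.
  by rewrite ler_wpM2r ?nrm_ge0 //; lra.
have [g G'g g0] := far_reaching_nonzero bG'; exfalso.
have [f1 [n hn] Bg] := aG _ (G'G _ G'g).
have k1 : N (Pr (predC (near_cell lam live h s)) g.1) <= M * L^-1 * N g.2.
  apply: (hM _ hn); first by rewrite invr_ge0 ltW.
  move=> i; rewrite (coord_coord_proj Q he) //= .
  have r0 : 0 <= L^-1 * rho (c g.2 i) by rewrite mulr_ge0 ?rho_ge0 // invr_ge0 ltW.
  case: ifP; last by rewrite rho0.
  rewrite /near_cell; have := dG _ (G'G _ G'g) i; case: (live i) => /=; last first.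
    by move=> ->; rewrite rho0.
  move=> -> hi; have Ll : L < rho (lam i).
    rewrite ltNge; apply/negP => /hs[a as_ ha]; move/hasP: hi; apply.
    by exists a.
  rewrite rhoM mulrA ler_peMl ?rho_ge0 // mulrC ler_pdivlMr // mul1r; exact: ltW.
have := hG' _ G'g; rewrite -/q.
have := nrmD Q (Pr (near_cell lam live h s) g.1) (Pr (predC (near_cell lam live h s)) g.1).
rewrite -(coord_proj_compl Q he) // => k2 k3.
have gp := nrm_gt0 Q g0.
have k4 : N (Pr (predC (near_cell lam live h s)) g.1) <= N g.1 / 4.
  apply: (le_trans k1); rewrite -[M / L]mulrC -mulrA mulrC ler_pdivrMr //.
  have : M * N g.2 <= M * (B * N g.1) by rewrite ler_wpM2l.
  rewrite /L; lra.
have : q * d' * N g.1 <= N g.1 / 4.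
  rewrite mulrC ler_wpM2l ?nrm_ge0 //; lra.
lra.
Qed.

End Diagonal.

(** On an infinite dimensional space of finitely supported vectors a bounded
    operator is, up to small errors and on a block sequence [y], block diagonal;
    its blocks [z] define the multiplier of ratios of coordinates. *)
Lemma approximate_eigenvalue (V : set X) (T : X -> X) (B d : R) :
  subspace V -> infinite_dim V -> (forall v, V v -> finsupp v) ->
  linear_on V T -> 0 <= B -> (forall v, V v -> N (T v) <= B * N v) -> 0 < d ->
  exists a, forall m, exists v n,
    [/\ V v, v != 0, supported m n v & N (T v - a *: v) <= d * N v].
Proof.
move=> sV iV fV lT B0 TB d0.
have [C C1 hC] := ps_bounded Q hb; have C0 : 0 < C by apply: lt_le_trans C1.
have [U U0 hU] := unconditional Q he; have [M M0 hM] := multiplier_bounded Q he.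
pose d' := Num.min 1 (d / 2).
have d'0 : 0 < d' by rewrite lt_min; apply/andP; split; lra.
have : d' <= d' by []; rewrite {2}/d' le_min => /andP[d'1 d'd].
pose dk k : R := d' / (2 * C) * 2^-1 ^+ k.+1.
have dk0 k : 0 < dk k by rewrite mulr_gt0 ?half_pow_gt0 // divr_gt0 // mulr_gt0.
have [|p [g hg]] := @dependent_blocks (X * X) (fun k m n g =>
    [/\ V g.1, g.1 != 0, supported m n g.1, supported m n g.2
      & N (T g.1 - g.2) <= dk k * N g.1]).
  move=> k m.
  (* The first [m] functionals are the coordinates of [v], the other [m] those
     of [T v]. *)
  have [|y [Vy y0 hy]] := @common_kernel _ _ V
      (fun j v => if (j < m)%N then c v j else c (T v) (j - m)%N) (m + m)%N sV iV.
    move=> j _ a u v Vu Vv; case: ifP => _; first by rewrite (coord_lin Q hb).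
    by rewrite lT // (coord_lin Q hb).
  have hy1 i : (i < m)%N -> c y i = 0.
    by move=> im; have := hy i; rewrite im; apply; rewrite ltn_addr.
  have hy2 i : (i < m)%N -> c (T y) i = 0.
    move=> im; have := hy (m + i)%N; rewrite [(m + i < m)%N]ltnNge leq_addr /= addKn.
    by rewrite ltn_add2l; apply.
  have yp := nrm_gt0 Q y0; have dy : 0 < dk k * N y by rewrite mulr_gt0.
  have [n1 hn1] := fV _ Vy; have [n2 hn2] := ps_cvg Q hb (T y) dy.
  pose n := maxn m (maxn n1 n2).
  have n1n : (n1 <= n)%N by rewrite /n !leq_max leqnn !orbT.
  have n2n : (n2 <= n)%N by rewrite /n !leq_max leqnn !orbT.
  exists n, (y, ps n (T y)); split; first exact: leq_maxl.
  split=> //=.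
  - move=> i; case: (ltnP i m) => [im _|mi /= ni]; first exact: hy1.
    apply: hn1; apply: contra ni => /= h; exact: leq_trans n1n.
  - move=> i; rewrite (coord_ps Q hb); case: (ltnP i m) => [im _|mi /= /negPf ->] //.
    by rewrite hy2 // if_same.
  - by rewrite nrmBC ltW // hn2.
pose y := fst \o g; pose z := snd \o g; pose r k := T (y k) - z k.
have bY : blocks e p y by move=> k; have [? []] := hg k.
have bZ : blocks e p z by move=> k; have [? []] := hg k.
have y0 k : y k != 0 by have [_ []] := hg k.
have Vy k : V (y k) by have [_ []] := hg k.
have Vcomb t n : V (comb y t n) by apply: subspace_sum => // k _; exact: subspaceZ.
have rE t n : T (comb y t n) - comb z t n = comb r t n.
  rewrite /comb (linear_on_sum _ sV lT) => [|k _]; last exact: subspaceZ.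
  rewrite -sumrB; apply: eq_bigr => k _.
  by rewrite (linear_onZ _ sV lT) // -scalerBr.
have rle t n : N (comb r t n) <= d' * N (comb y t n).
  have := @block_perturbation _ _ Q _ e hb C hC p y r dk t n bY (fun k => ltW (dk0 k)).
  move=> /(_ (fun k => let: conj _ (And5 _ _ _ _ h) := hg k in h)) h.
  apply: le_trans h _; rewrite ler_wpM2r ?nrm_ge0 // /dk -mulr_sumr half_pow_sum mulrA.
  have -> : 2 * C * (d' / (2 * C)) = d' by field; rewrite lt0r_neq0.
  by have := half_pow_gt0 R n; rewrite ler_piMr //; lra.
have bG : far_reaching (span_seq g) by exact: (far_reaching_span Q he bY y0).
have aG : admissible (B + 1) (span_seq g).
  move=> _ [t [n ->]]; rewrite comb_fst comb_snd -/y -/z.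
  split; [by exists (p n); exact: (comb_supported Q hb) | by exists (p n); exact: (comb_supported Q hb) |].
  have := rle t n; rewrite -rE => h; have := TB _ (Vcomb t n).
  have := nrmB Q (T (comb y t n)) (T (comb y t n) - comb z t n); rewrite subKr.
  have : d' * N (comb y t n) <= 1 * N (comb y t n) by rewrite ler_wpM2r ?nrm_ge0.
  lra.
(* [blk i] is the index of the block that is alive at the coordinate [i]. *)
pose live : pred nat := fun i => `[< exists k, c (y k) i != 0 >].
pose blk i := xget 0%N [set k | c (y k) i != 0].
pose lam i := c (z (blk i)) i / c (y (blk i)) i.
have dG : diagonal lam live (span_seq g).
  move=> _ [t [n ->]] i; rewrite comb_fst comb_snd -/y -/z; case: ifP => [/asboolP|/asboolPn] h.
    have yi : c (y (blk i)) i != 0 by apply: (xgetPex 0%N h).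
    have hi : (p (blk i) <= i < p (blk i).+1)%N.
      by apply: contraT => /(bY (blk i)).2 h'; rewrite h' eqxx in yi.
    rewrite (blocks_comb_coord Q hb _ _ bY hi) (blocks_comb_coord Q hb _ _ bZ hi).
    case: ifP => _; last by rewrite mulr0.
    by rewrite /lam mulrCA divfK.
  rewrite (coord_sum Q hb) big1 // => k _; rewrite (coordZ Q hb).
  have [->|yk] := eqVneq (c (y k) i) 0; first by rewrite mulr0.
  by exfalso; apply: h; exists k.
have [||a [G' [bG' G'G hG']]] := @diagonal_eigenvalue U U0 hU M M0 hM (B + 1) _ lam live (d / 2) _ _ bG aG dG.
- lra.
- lra.
exists a => m; have [f [n [G'f f0 sf]]] := bG'.2 m.
exists f.1, n; have hf := hG' _ G'f; have [t [l fE]] := G'G _ G'f.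
have f1E : f.1 = comb y t l by rewrite fE comb_fst.
have f2E : f.2 = comb z t l by rewrite fE comb_snd.
split=> //; first by rewrite f1E.
have := rle t l; rewrite -rE -f1E -f2E => h.
have := nrmD Q (T f.1 - f.2) (f.2 - a *: f.1); rewrite addrA subrK.
have : d' * N f.1 <= d / 2 * N f.1 by rewrite ler_wpM2r ?nrm_ge0.
lra.
Qed.

End ApproximateEigenvalues.
(** * Norming functionals *)

Section HahnBanach.
Context {R : realType} {K : numFieldType} (Q : real_scalars R K).
Context {X : completeNormedModType K}.
Implicit Types (l : nat -> X) (r t : nat -> R).
Local Notation N := (nrm Q).
Local Notation rho := (rho Q).
Local Notation emb := (emb Q).

(** The supremum of the lower constraints is an admissible value on the next
    vector.  The domination is phrased with coefficients, which allows the
    vectors [l] to be dependent. *)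
Lemma real_hahn_banach l n : exists r, r 0%N = N (l 0%N) /\
  forall t, \sum_(j < n.+1) t j * r j <= N (\sum_(j < n.+1) emb (t j) *: l j).
Proof.
elim: n => [|n [r [r0 hr]]].
  exists (fun=> N (l 0%N)); split=> // t; rewrite !big_ord1 nrmZ rho_emb.
  by rewrite ler_wpM2r ?nrm_ge0 // ler_norm.
pose v := l n.+1.
pose f t := \sum_(j < n.+1) t j * r j; pose L t := \sum_(j < n.+1) emb (t j) *: l j.
have fZ a t : f (fun j => a * t j) = a * f t.
  by rewrite /f mulr_sumr; apply: eq_bigr => j _; rewrite mulrA.
have LZ a t : L (fun j => a * t j) = emb a *: L t.
  by rewrite /L scaler_sumr; apply: eq_bigr => j _; rewrite rmorphM /= scalerA.
have cross t t' : f t - N (L t - v) <= N (L t' + v) - f t'.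
  have : f (fun j => t j + t' j) <= N (L (fun j => t j + t' j)) by exact: hr.
  have -> : f (fun j => t j + t' j) = f t + f t'.
    by rewrite /f -big_split /=; apply: eq_bigr => j _; rewrite mulrDl.
  have -> : L (fun j => t j + t' j) = (L t - v) + (L t' + v).
    rewrite [L t' + v]addrC addrA subrK /L -big_split /=; apply: eq_bigr => j _.
    by rewrite rmorphD /= scalerDl.
  by have := nrmD Q (L t - v) (L t' + v); lra.
pose A := [set f t - N (L t - v) | t in [set: nat -> R]].
pose s := sup A.
have A0 : A !=set0 by exists (f (fun=> 0) - N (L (fun=> 0) - v)); exists (fun=> 0).
have sle t : f t - N (L t - v) <= s.
  apply: ub_le_sup; last by exists t.
  by exists (N (L (fun=> 0) + v) - f (fun=> 0)) => _ [t' _ <-]; exact: cross.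
have les t : s <= N (L t + v) - f t.
  by apply: ge_sup => // _ [t' _ <-]; exact: cross.
(* [s] meets the lower and the upper constraints on the value at [v]. *)
exists (fun j => if j == n.+1 then s else r j); split=> // t.
rewrite big_ord_recr [X in _ <= N X]big_ord_recr /= eqxx.
rewrite [X in X + _ <= _](_ : _ = f t); last first.
  by rewrite /f; apply: eq_bigr => j _; rewrite /= ltn_eqF.
rewrite -/(L t) -/v; set a := t n.+1.
have [a0|a0|a0] := ltgtP a 0.
- have b0 : 0 < - a by lra.
  have := sle (fun j => (- a)^-1 * t j); rewrite fZ LZ => h.
  have : - a * ((- a)^-1 * f t - N (emb (- a)^-1 *: L t - v)) <= - a * s.
    by rewrite ler_wpM2l // ltW.
  rewrite mulrBr mulrA divff ?mul1r ?lt0r_neq0 //.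
  have -> : - a * N (emb (- a)^-1 *: L t - v) = N (L t + emb a *: v).
    have {1}-> : - a = rho (emb (- a)) by rewrite rho_emb gtr0_norm.
    rewrite -nrmZ scalerBr scalerA -rmorphM /= divff ?lt0r_neq0 // rmorph1 scale1r.
    by rewrite rmorphN /= scaleNr opprK.
  lra.
- have := les (fun j => a^-1 * t j); rewrite fZ LZ => h.
  have : a * s <= a * (N (emb a^-1 *: L t + v) - a^-1 * f t).
    by rewrite ler_wpM2l // ltW.
  rewrite mulrBr mulrA divff ?mul1r ?lt0r_neq0 //.
  have -> : a * N (emb a^-1 *: L t + v) = N (L t + emb a *: v).
    have {1}-> : a = rho (emb a) by rewrite rho_emb gtr0_norm.
    by rewrite -nrmZ scalerDr scalerA -rmorphM /= divff ?lt0r_neq0 // rmorph1 scale1r.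
  lra.
- by rewrite a0 rmorph0 scale0r mul0r !addr0; exact: hr.
Qed.

Lemma sum_double (V : nmodType) (F : nat -> V) n :
  \sum_(k < n.*2) F k = \sum_(j < n) (F j.*2 + F j.*2.+1).
Proof.
elim: n => [|n IH]; first by rewrite !big_ord0.
by rewrite doubleS !big_ord_recr /= IH addrA.
Qed.

Context (e : nat -> X) (hb : schauder_basis e).
Local Notation c := (basis_coord e).
Local Notation supported := (supported e).

(** For complex scalars let [u] be a real functional dominated by the norm on the
    real span of [w] and of all [e i] and ['i *: e i].  It is the real part of the
    complex functional [v |-> u v - 'i * u ('i *: v)], whose value at [e i] is
    [psi i] below.  For real scalars [imu = 0] makes the same formula valid. *)
Lemma norming_functional w n : w != 0 -> supported 0 n w ->
  exists phi : nat -> K, \sum_(i < n) c w i * phi i = 1 /\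
    forall v, supported 0 n v -> rho (\sum_(i < n) c v i * phi i) * N w <= N v.
Proof.
move=> w0 sw; have wp := nrm_gt0 Q w0.
pose l k := if k is k'.+1 then (if odd k' then imu Q *: e k'./2 else e k'./2) else w.
have [r [r0 hr]] := real_hahn_banach l n.*2.
pose psi i : K := emb (r i.*2.+1) - imu Q * emb (r i.*2.+2).
pose f v := \sum_(i < n) c v i * psi i.
have re0 : re Q 0 = 0 by rewrite -(rmorph0 emb) re_emb.
have fre a v : supported 0 n v -> a * N w + re Q (f v) <= N (emb a *: w + v).
  move=> sv.
  pose t k := if k is k'.+1 then (if odd k' then im Q (c v k'./2) else re Q (c v k'./2)) else a.
  have := hr t; rewrite !big_ord_recl /= r0.
  rewrite (sum_double (fun k => t k.+1 * r k.+1)).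
  rewrite (sum_double (fun k => emb (t k.+1) *: l k.+1)) /=.
  have -> : \sum_(j < n) ((if odd j.*2 then im Q (c v j.*2./2) else re Q (c v j.*2./2)) * r j.*2.+1
     + (if ~~ odd j.*2 then im Q (c v (uphalf j.*2)) else re Q (c v (uphalf j.*2))) * r j.*2.+2)
     = re Q (f v).
    rewrite /f (big_morph (re Q) (reD Q) re0); apply: eq_bigr => i _.
    by rewrite odd_double /= doubleK uphalf_double re_dual.
  congr (_ <= N (_ + _)).
  rewrite -[RHS](supported_ps Q hb sv) /partial_sum /trunc_proj; apply: eq_bigr => i _.
  rewrite odd_double /= doubleK uphalf_double scalerA -scalerDl.
  by rewrite {3}(re_imE Q (c v i)) [imu Q * _]mulrC.
have fZ a v : f (a *: v) = a * f v.
  by rewrite /f mulr_sumr; apply: eq_bigr => i _; rewrite (coordZ Q hb) mulrA.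
have sZ a v : supported 0 n v -> supported 0 n (a *: v).
  exact: (subspaceZ _ (supported_subspace Q hb _ _)).
have fle v : supported 0 n v -> rho (f v) <= N v.
  move=> sv; have [->|fv] := eqVneq (f v) 0; first by rewrite rho0 nrm_ge0.
  pose a := emb (rho (f v)) / f v.
  have := fre 0 _ (sZ a _ sv); rewrite rmorph0 scale0r mul0r !add0r fZ divfK // re_emb.
  by rewrite nrmZ rhoM rhoV rho_emb ger0_norm ?rho_ge0 // divff ?mul1r // lt0r_neq0 // rho_gt0.
have fw : N w <= rho (f w).
  have := fre 1 _ (sZ (-1) _ sw); rewrite rmorph1 scale1r scaleN1r subrr nrm0 -scaleN1r fZ mulN1r.
  have -> : re Q (- f w) = - re Q (f w).
    by have := reZ Q (-1) (f w); rewrite rmorphN rmorph1 !mulN1r.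
  by have := re_le_rho Q (f w); have := ler_norm (re Q (f w)); lra.
have fw0 : f w != 0 by apply/eqP => h; move: fw; rewrite h rho0; lra.
exists (fun i => psi i / f w).
have fE v : \sum_(i < n) c v i * (psi i / f w) = f v / f w.
  by rewrite /f mulr_suml; apply: eq_bigr => i _; rewrite mulrA.
split=> [|v sv]; rewrite fE ?divff // rhoM rhoV -mulrA.
have : (rho (f w))^-1 * N w <= 1 by rewrite mulrC ler_pdivrMr ?mul1r // rho_gt0.
move=> h; apply: le_trans (fle _ sv); rewrite ler_piMr ?rho_ge0 //.
Qed.

End HahnBanach.
(** * The strictly singular perturbation *)

Section Blocks.
Context {R : realType} {K : numFieldType} (Q : real_scalars R K).
Context {X : completeNormedModType K} (e : nat -> X) (hb : schauder_basis e).
Implicit Types (x y w : nat -> X).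
Local Notation N := (nrm Q).
Local Notation rho := (rho Q).
Local Notation c := (basis_coord e).
Local Notation ps := (partial_sum e).
Local Notation finsupp := (finsupp e).
Local Notation supported := (supported e).

Lemma coord_neq0 (u : X) : u != 0 -> exists i, c u i != 0.
Proof.
move=> u0; apply: contrapT => h; move/eqP: u0; apply; apply: (coord_inj Q hb) => i.
rewrite (coord0 Q hb); apply/eqP; apply: contrapT => /negP ui; apply: h; by exists i.
Qed.

Lemma block_sequenceP x : block_sequence e x <->
  (forall k, x k != 0) /\ exists p, blocks e p x.
Proof.
split=> [[x1 x2]|[x0 [p hp]]]; last first.
  split=> [n|n i j].
    split=> //; apply: (@sub_finite_set _ _ `I_(p n.+1)); last exact: finite_II.
    move=> i /= xi; rewrite ltnNge; apply/negP => h; move/eqP: xi; apply.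
    by apply: (hp n).2; rewrite negb_and -leqNgt h orbT.
  have inb k l : supp e (x k) l -> (p k <= l < p k.+1)%N.
    by move=> xl; apply: contraT => /(hp k).2 h; rewrite /supp /= h eqxx in xl.
  by move=> /inb/andP[_ h1] /inb/andP[h2 _]; exact: leq_trans h1 h2.
split=> [k|]; first by have [] := x1 k.
have /choice[b hbd] : forall k, exists b, c (x k) b != 0 /\ forall i, c (x k) i != 0 -> (i <= b)%N.
  move=> k; have [x0 /finite_seqP[s hs]] := x1 k.
  have ex := coord_neq0 x0.
  have bd i : c (x k) i != 0 -> (i <= \max_(j <- s) j)%N.
    move=> xi; have : supp e (x k) i by []; rewrite hs /= => si.
    by rewrite (big_rem i) //= leq_maxl.
  by exists (ex_maxn ex bd); case: ex_maxnP.
(* [b k] is the last index in the support of [x k]. *)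
exists (fun k => if k is k'.+1 then (b k').+1 else 0%N) => k; split.
  case: k => [//|k]; rewrite ltnS ltnW //.
  exact: x2 (hbd k).1 (hbd k.+1).1.
move=> i hi; apply/eqP; apply: contraT => xi; exfalso; move/negP: hi; apply.
rewrite ltnS (hbd k).2 // andbT; case: k xi => [//|k] xi.
exact: x2 (hbd k).1 xi.
Qed.

End Blocks.

Section Nuclear.
Context {R : realType} {K : numFieldType} (Q : real_scalars R K).
Context {X : completeNormedModType K} (e : nat -> X) (hb : schauder_basis e).
Implicit Types (x y w : nat -> X).
Local Notation N := (nrm Q).
Local Notation rho := (rho Q).
Local Notation c := (basis_coord e).
Local Notation ps := (partial_sum e).
Local Notation supported := (supported e).
Local Notation ncvg := (ncvg Q).

(** The [k]-th functional is a norming functional of [w k] composed with the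
    projection onto the interval that carries [w k]; disjointness of these
    intervals gives biorthogonality. *)
Lemma biorthogonal p w : blocks e p w -> (forall k, w k != 0) ->
  exists (f : nat -> X -> K) (D : R), [/\ 0 <= D,
    forall k, linear_on setT (f k : X -> K^o),
    forall k j, f k (w j) = (j == k)%:R &
    forall k v, rho (f k v) * N (w k) <= D * N v].
Proof.
move=> hp w0; have [C C1 hC] := ps_bounded Q hb.
pose Itv k v := ps (p k.+1) v - ps (p k) v.
have sI k v : supported (p k) (p k.+1) (Itv k v).
  exact: (supported_ps_diff Q hb _ (hp k).1).
have sw k : supported 0 (p k.+1) (w k) by apply: supportedW (hp k).2.
have /choice[phi hphi] k := norming_functional Q hb (w0 k) (sw k).
exists (fun k v => \sum_(i < p k.+1) c (Itv k v) i * phi k i), (2 * C); split.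
- lra.
- move=> k a u v _ _; rewrite scaler_sumr -big_split /=; apply: eq_bigr => i _.
  rewrite /Itv !(coordB Q hb) !(coord_ps Q hb) !(coord_lin Q hb) /GRing.scale /=.
  by case: ifP => _; case: ifP => _; ring.
- move=> k j; have [->|jk] := eqVneq j k.
    rewrite -(hphi k).1; apply: eq_bigr => i _; congr (_ * _).
    rewrite /Itv (coordB Q hb) !(coord_ps Q hb) ltn_ord.
    case: ltnP => ik; last by rewrite subr0.
    by rewrite subrr (hp k).2 // negb_and -ltnNge ik.
  rewrite big1 // => i _; rewrite [c _ _](_ : _ = 0) ?mul0r //.
  have [ki|ki] := boolP (p k <= i < p k.+1)%N; last exact: sI.
  rewrite /Itv (coordB Q hb) !(coord_ps Q hb) (blocks_coord0 hp ki jk).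
  by rewrite !if_same subrr.
- move=> k v; apply: le_trans (ps_diff_le hC (p k) (p k.+1) v).
  by apply: (hphi k).2; apply: supportedW (sI k v).
Qed.

Section Series.
Context (f : nat -> X -> K) (s w : nat -> X) (D : R).
Context (D0 : 0 <= D) (lf : forall k, linear_on setT (f k : X -> K^o)).
Context (fD : forall k v, rho (f k v) * N (w k) <= D * N v).
Context (sw : forall k, N (s k) <= 2^-1 ^+ k * N (w k)).

(** The [k]-th term of the series [sum_k f k v *: s k] has norm at most
    [2^-1 ^+ k * (D * N v)]. *)
Lemma nuclear_operator : exists2 S : X -> X, bounded_operator setT S &
  forall v m, N (S v - \sum_(k < m) f k v *: s k) <= 2 * (D * N v) * 2^-1 ^+ m.
Proof.
pose part v m := \sum_(k < m) f k v *: s k.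
have /choice[S hS] : forall v, exists u : X, ncvg (part v) u /\
    forall m, N (u - part v m) <= 2 * (D * N v) * 2^-1 ^+ m.
  move=> v; have [|u u1 u2] := @geometric_cvg _ _ Q X (part v) (D * N v); last by exists u.
  move=> k; rewrite /part big_ord_recr /= addrAC subrr add0r nrmZ.
  apply: le_trans (ler_wpM2l (rho_ge0 Q _) (sw k)) _.
  by rewrite mulrCA mulrC ler_wpM2r // ltW // half_pow_gt0.
exists S; last by move=> v; exact: (hS v).2.
apply/(bounded_operatorP Q); split.
  move=> a u v _ _; apply: (ncvg_unique (hS _).1).
  have := ncvg_lin a (hS u).1 (hS v).1; congr (ncvg _ _).
  apply/funext => m; rewrite /part scaler_sumr -big_split /=; apply: eq_bigr => k _.
  by rewrite lf // scalerDl scalerA.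
exists (2 * D) => [|v _]; first by have := D0; lra.
by have := (hS v).2 0%N; rewrite /part big_ord0 subr0 expr0 mulr1 mulrA.
Qed.

(** On the common kernel of the first [m] functionals the operator has norm at
    most [2 * D * 2^-1 ^+ m]. *)
Lemma nuclear_strictly_singular S (V : set X) :
  (forall v m, N (S v - \sum_(k < m) f k v *: s k) <= 2 * (D * N v) * 2^-1 ^+ m) ->
  strictly_singular V S.
Proof.
move=> hS V' /closed_subspaceP[_ sV'] _ iV' [_ _ [T' /(bounded_operatorP Q)[_ [M M0 hM]] ST']].
have [m hm] := half_pow_small (M * (2 * D)) ltr01.
have [|v [Vv v0 fv]] := @common_kernel _ _ V' f m sV' iV'.
  by move=> k _ a u v _ _; exact: lf.
have vp := nrm_gt0 Q v0.
have := hS v m; rewrite big1 ?subr0 => [|k _]; last by rewrite fv ?scale0r.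
have := hM (S v); rewrite ST' ?in_setE // => h1 h2.
have {}h1 : N v <= M * N (S v) by apply: h1; exists v.
have : M * N (S v) <= M * (2 * (D * N v) * 2^-1 ^+ m) by rewrite ler_wpM2l.
have -> : M * (2 * (D * N v) * 2^-1 ^+ m) = M * (2 * D) * 2^-1 ^+ m * N v by ring.
have : M * (2 * D) * 2^-1 ^+ m * N v < 1 * N v by rewrite ltr_pM2r.
lra.
Qed.

End Series.
End Nuclear.

(** The approximate eigenvalues for the precisions [2^-1 ^+ k] are bounded, and a
    cluster point of them is an approximate eigenvalue for every precision, on
    vectors supported arbitrarily far out. *)
Lemma block_eigen_limit (R : realType) (K : numFieldType) (Q : real_scalars R K)
    (X : completeNormedModType K) (e : nat -> X) (he : tight_by_support e)
    (V : set X) (T : X -> X) (B : R) :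
  subspace V -> infinite_dim V -> (forall v, V v -> finsupp e v) ->
  linear_on V T -> 0 <= B -> (forall v, V v -> nrm Q (T v) <= B * nrm Q v) ->
  exists (a : K) p (w : nat -> X), [/\ blocks e p w, forall k, w k != 0,
    forall k, V (w k) &
    forall k, nrm Q (T (w k) - a *: w k) <= 2^-1 ^+ k * nrm Q (w k)].
Proof.
move=> sV iV fV lT B0 TB.
have /choice[b hbk] k := approximate_eigenvalue he sV iV fV lT B0 TB (half_pow_gt0 R k).
have bB k : rho Q (b k) <= B + 1.
  have [v [n [Vv v0 _ hv]]] := hbk k 0%N; have vp := nrm_gt0 Q v0.
  rewrite -(ler_pM2r vp) -nrmZ.
  have := nrmB Q (T v) (T v - b k *: v); rewrite subKr; have := TB _ Vv.
  have : 2^-1 ^+ k * nrm Q v <= 1 * nrm Q v.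
    by rewrite ler_wpM2r ?nrm_ge0 // exprn_ile1 //; lra.
  lra.
have [a ha] := bounded_cluster bB.
have [|p [w hw]] := @dependent_blocks X (fun k m n v =>
    [/\ V v, v != 0, supported e m n v & nrm Q (T v - a *: v) <= 2^-1 ^+ k * nrm Q v]).
  move=> k m; have e1 : 0 < 2^-1 ^+ k / 2 :> R by rewrite divr_gt0 // half_pow_gt0.
  have [j jk baj] := ha _ e1 k.+1.
  have [v [n [Vv v0 sv hv]]] := hbk j m.
  exists (maxn m n), v; split; first exact: leq_maxl.
  split=> //; first exact: supportedW (leqnn m) (leq_maxr m n) sv.
  have -> : T v - a *: v = (T v - b j *: v) + (b j - a) *: v.
    by rewrite scalerBl addrA subrK.
  apply: le_trans (nrmD _ _ _) _; rewrite nrmZ.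
  have : 2^-1 ^+ j * nrm Q v <= 2^-1 ^+ k / 2 * nrm Q v.
    rewrite ler_wpM2r ?nrm_ge0 // -exprSr ler_wiXn2l //; lra.
  have : rho Q (b j - a) * nrm Q v <= 2^-1 ^+ k / 2 * nrm Q v.
    by rewrite ler_wpM2r ?nrm_ge0 // ltW.
  lra.
exists a, p, w; split=> [k|k|k|k]; have [? []] := hw k => //.
Qed.

Theorem theorem1p5 (R : realType) (K : numFieldType)
    (hK : K = (R : numFieldType) \/ K = (R[i] : numFieldType))
    (X : completeNormedModType K) (e : nat -> X) (he : tight_by_support e)
    (x : nat -> X) (hx : block_sequence e x)
    (T : X -> X) (hT : bounded_operator (closed_span x) T) :
  exists (W : set X) (alpha : K) (S : X -> X),
    [/\ block_subspace e W, infinite_dim W & W `<=` closed_span x] /\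
    [/\ bounded_operator (closed_span x) S,
        strictly_singular (closed_span x) S &
        forall w, W w -> T w = alpha *: w + S w].
Proof.
have [Q] := real_scalars_exist hK.
have [hb _] := he; have [C C1 hC] := ps_bounded Q hb.
have [x0 [px hpx]] := (block_sequenceP Q hb x).1 hx.
have [lT [B B0 TB]] := (bounded_operatorP Q _ _).1 hT.
have xsub u : span_seq x u -> closed_span x u by exact: closed_span_sub.
have sx : subspace (closed_span x) by exact: (closed_span_subspace Q).
have [||||a [p [w [hp w0 Vw aw]]]] := @block_eigen_limit R K Q X e he (span_seq x) T B
    (span_seq_subspace x) _ _ _ B0.
- exact: free_seq_infinite_dim (block_free hb hC hpx x0) (@span_seq_mem _ _ x).
- by move=> _ [t [n ->]]; exists (px n); exact: (comb_supported Q hb).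
- by move=> c' u v /xsub xu /xsub xv; exact: lT.
- by move=> v /xsub; exact: TB.
have [f [D [D0 lf fw fD]]] := biorthogonal Q hb hp w0.
pose s k := T (w k) - a *: w k.
have [S bS hS] := nuclear_operator D0 lf fD aw.
have [lS [BS BS0 SB]] := (bounded_operatorP Q _ _).1 bS.
have Wx : closed_span w `<=` closed_span x.
  by apply: (closed_span_min (closed_span_closed_subspace Q x)) => k; apply: xsub.
exists (closed_span w), a, S; split.
  split=> //; first by exists w => //; apply/(block_sequenceP Q hb); split=> //; exists p.
  apply: free_seq_infinite_dim (block_free hb hC hp w0) _ => k.
  by apply: closed_span_sub; exact: span_seq_mem.
split.
- apply/(bounded_operatorP Q); split; first by move=> c' u v _ _; exact: lS.
  by exists BS => // v _; exact: SB.
- exact: (@nuclear_strictly_singular _ _ Q X f s D lf S _ hS).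
(* [E] is bounded and vanishes on each [w k], hence on their closed span. *)
pose E u := T u - a *: u - S u.
suff E0 : forall u, closed_span w u -> E u = 0.
  by move=> u /E0/eqP; rewrite /E subr_eq0 subr_eq addrC => /eqP.
(* By biorthogonality all partial sums of [S (w k)] beyond [k] equal [s k]. *)
have Sw k : S (w k) = s k.
  apply/eqP; rewrite -subr_eq0; apply/eqP; apply: (@nrm_small0 _ _ Q) => d d0.
  have [m hm] := half_pow_small (2 * (D * nrm Q (w k))) d0.
  have := hS (w k) (maxn m k.+1).
  have km : (k < maxn m k.+1)%N by rewrite leq_max leqnn orbT.
  rewrite (bigD1 (Ordinal km)) //= fw eqxx scale1r big1 ?addr0 => [h|j jk]; last first.
    rewrite fw (_ : (k == j) = false) ?scale0r //.
    by apply/negbTE; apply: contra jk => /eqP kj; apply/eqP/val_inj.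
  apply: (le_trans h); apply: le_trans (ltW hm).
  rewrite ler_wpM2l ?ler_wiXn2l ?leq_maxl //; try lra.
  by rewrite !mulr_ge0 ?nrm_ge0.
have Elin : linear_on (closed_span x) E.
  move=> c' u v xu xv; rewrite /E lT // lS // !scalerBr !scalerDr !scalerA [a * c']mulrC.
  rewrite !opprD !addrA; set a1 := c' *: T u; set a2 := T v; set a3 := (c' * a) *: u.
  set a4 := a *: v; set a5 := c' *: S u; set a6 := S v.
  by rewrite (ACl (1*3*5*2*4*6)).
have EB u : closed_span x u -> nrm Q (E u) <= (B + rho Q a + BS) * nrm Q u.
  move=> xu; have := nrmB Q (T u - a *: u) (S u); have := nrmB Q (T u) (a *: u).
  by rewrite nrmZ; have := TB _ xu; have := SB u Logic.I; rewrite /E; lra.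
have Espan : span_seq w `<=` [set u | closed_span x u /\ E u = 0].
  apply: span_seq_min => [|k].
    split; first by split; [exact: sx.1 | exact: linear_on0 sx Elin].
    move=> c' u v [xu Eu] [xv Ev]; split; first exact: sx.2.
    by rewrite Elin // Eu Ev scaler0 addr0.
  by split; [exact: xsub | rewrite /E Sw /s subrr].
move=> u wu; apply: (@nrm_small0 _ _ Q) => d d0.
have Bp : 0 < B + rho Q a + BS + 1 by have := rho_ge0 Q a; lra.
have d1 : 0 < d / (B + rho Q a + BS + 1) by rewrite divr_gt0.
move: (wu); rewrite closed_spanE => /(closureP Q)/(_ _ d1)[v wv uv].
have [xv Ev] := Espan _ wv.
have -> : E u = E (u - v) by rewrite (linear_onB sx Elin) ?Ev ?subr0 //; exact: Wx.
apply: (le_trans (EB _ (subspaceB sx (Wx _ wu) xv))).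
move: uv; rewrite ltr_pdivlMr // => uv.
by have := nrm_ge0 Q (u - v); lra.
Qed.
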